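(* Let $\mathcal{C}$ be an internal category in the category of topological spaces such that, for every $k\ge 0$, the space $\operatorname{Ner}_{k}\mathcal{C}$ has the homotopy type of a CW-complex. Then the canonical projection $$\pi:\Vert \operatorname{Ner}_{\cdot}\mathcal{C}\times S_{\cdot}\Vert\longrightarrow \Vert \operatorname{Ner}_{\cdot}\mathcal{C}\Vert$$ is a homotopy equivalence.
   Context: An internal category $\mathcal{C}$ in topological spaces consists of a space of objects $O(\mathcal{C})$, a space of morphisms $M(\mathcal{C})$, and continuous source, target, identity and composition maps satisfying the category axioms. Its nerve $\operatorname{Ner}_{\cdot}\mathcal{C}$ is the simplicial space with $\operatorname{Ner}_{0}\mathcal{C}=O(\mathcal{C})$ and $\operatorname{Ner}_{k}\mathcal{C}=M(\mathcal{C})\times_{O(\mathcal{C})}\cdots\times_{O(\mathcal{C})}M(\mathcal{C})$ ($k$ factors, the space of composable $k$-tuples) for $k\ge 1$, with the usual face and degeneracy maps. $S_{\cdot}$ is the semi-simplicial set (viewed as a discrete semi-simplicial space) with $S_{k}$ the set of strictly increasing maps $[k]=\{0<1<\dots<k\}\to\mathbb{N}$, with face maps given by precomposition with the coface maps $[k-1]\to[k]$. For a semi-simplicial space $Y_{\cdot}$ (in particular for the underlying semi-simplicial space of a simplicial space), the fat realization is the quotient space $\Vert Y_{\cdot}\Vert=\coprod_{k}Y_{k}\times\triangle^{k}/\!\sim$, where $(d_{i}y,t)\sim(y,\delta_{i}t)$ for all face maps $d_i$ and corresponding coface inclusions $\delta_i$ of standard simplices. For a simplicial space $X_\cdot$,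 $X_{\cdot}\times S_{\cdot}$ is the semi-simplicial space with $k$-th space $X_{k}\times S_{k}$ and componentwise face maps. The canonical projection $\pi$ is induced by the projections $X_{k}\times S_{k}\to X_{k}$ (here with $X_\cdot=\operatorname{Ner}_\cdot\mathcal{C}$). *)

(* Defs.v *)
From HB Require Import structures.
From Stdlib Require Import Relation_Operators.
From mathcomp Require Import all_boot all_order all_algebra generic_quotient.
From mathcomp Require Import all_classical all_reals all_analysis.
From mathcomp Require Import zify.

Set Implicit Arguments.
Unset Strict Implicit.
Unset Printing Implicit Defensive.

Import Order.TTheory GRing.Theory Num.Theory.
Import numFieldNormedType.Exports.

Local Open Scope classical_set_scope.
Local Open Scope ring_scope.
Local Open Scope quotient_scope.

Definition homotopic (R : realType) (X Y : topologicalType) (f g : X -> Y) :=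
  exists H : X * R -> Y,
    [/\ {within [set: X] `*` `[0, 1], continuous H},
        forall x, H (x, 0) = f x
      & forall x, H (x, 1) = g x].

Definition homotopy_equivalence (R : realType) (X Y : topologicalType)
    (f : X -> Y) :=
  continuous f /\
  exists g : Y -> X,
    [/\ continuous g, homotopic R (g \o f) id & homotopic R (f \o g) id].

(* The library norm on row vectors is the sup norm; the Euclidean one is used
   here. For n = 0 both disks are the point and the sphere is
   empty. *)
Definition disk (R : realType) n : set 'rV[R]_n :=
  [set v | \sum_i v 0 i ^+ 2 <= 1].
Definition open_disk (R : realType) n : set 'rV[R]_n :=
  [set v | \sum_i v 0 i ^+ 2 < 1].
Definition sphere (R : realType) n : set 'rV[R]_n :=
  [set v | \sum_i v 0 i ^+ 2 = 1].
Arguments disk : clear implicits.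
Arguments open_disk : clear implicits.
Arguments sphere : clear implicits.

(* A CW-structure in the sense of J.H.C. Whitehead; [char e] only matters on the
   disk. *)
Record cw_structure (R : realType) (X : topologicalType) := CWStructure {
  cell : nat -> Type;
  char : forall n, cell n -> 'rV[R]_n -> X;
  cw_hausdorff : hausdorff_space X;
  char_continuous : forall n (e : cell n),
    {within disk R n, continuous (char e)};
  (* the open cells partition X and each open disk maps bijectively onto its
     open cell *)
  char_partition : forall x : X,
    exists! p : {n & (cell n * 'rV[R]_n)%type},
      open_disk R (projT1 p) (projT2 p).2 /\
      char (projT2 p).1 (projT2 p).2 = x;
  (* the inverse of this bijection is continuous *)
  char_homeo : forall n (e : cell n) (U : set 'rV[R]_n), open U ->
    exists2 V : set X, open V &
      char e @` (U `&` open_disk R n) = V `&` char e @` open_disk R n;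
  closure_finite : forall n (e : cell n),
    exists2 F : set {m & cell m}, finite_set F &
      (forall c, F c -> (projT1 c < n)%N) /\
      char e @` sphere R n `<=`
        \bigcup_(c in F) char (projT2 c) @` open_disk R (projT1 c);
  weak_topology : forall A : set X,
    (forall n (e : cell n), closed (disk R n `&` char e @^-1` A)) -> closed A
}.

Definition has_CW_homotopy_type (R : realType) (X : topologicalType) :=
  exists K : topologicalType,
    inhabited (cw_structure R K) /\
    exists f : X -> K, homotopy_equivalence R f.

Definition weakly_increasing m n (a : 'I_m.+1 -> 'I_n.+1) :=
  {homo a : i j / (i <= j)%N}.
Definition strictly_increasing m n (a : 'I_m.+1 -> 'I_n.+1) :=
  {homo a : i j / (i < j)%N}.

Record simplicial_space := SimplicialSpace {
  sp_space :> nat -> topologicalType;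
  sp_map : forall m n (a : 'I_m.+1 -> 'I_n.+1),
    weakly_increasing a -> sp_space n -> sp_space m;
  sp_map_continuous : forall m n (a : 'I_m.+1 -> 'I_n.+1)
    (ha : weakly_increasing a), continuous (sp_map ha);
  sp_map_id : forall n (h : weakly_increasing (@id 'I_n.+1)) x,
    sp_map h x = x;
  sp_map_comp : forall l m n (a : 'I_m.+1 -> 'I_n.+1) (b : 'I_l.+1 -> 'I_m.+1)
    (ha : weakly_increasing a) (hb : weakly_increasing b)
    (hab : weakly_increasing (a \o b)) x,
    sp_map hab x = sp_map hb (sp_map ha x)
}.

Record semi_simplicial_space := SemiSimplicialSpace {
  ss_space :> nat -> topologicalType;
  ss_map : forall m n (a : 'I_m.+1 -> 'I_n.+1),
    strictly_increasing a -> ss_space n -> ss_space m;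
  ss_map_continuous : forall m n (a : 'I_m.+1 -> 'I_n.+1)
    (ha : strictly_increasing a), continuous (ss_map ha);
  ss_map_id : forall n (h : strictly_increasing (@id 'I_n.+1)) x,
    ss_map h x = x;
  ss_map_comp : forall l m n (a : 'I_m.+1 -> 'I_n.+1) (b : 'I_l.+1 -> 'I_m.+1)
    (ha : strictly_increasing a) (hb : strictly_increasing b)
    (hab : strictly_increasing (a \o b)) x,
    ss_map hab x = ss_map hb (ss_map ha x)
}.

Lemma strictly_weakly m n (a : 'I_m.+1 -> 'I_n.+1) :
  strictly_increasing a -> weakly_increasing a.
Proof.
move=> ha i j; rewrite leq_eqVlt => /orP[/eqP/val_inj -> //|/ha].
exact: ltnW.
Qed.

Definition underlying (X : simplicial_space) : semi_simplicial_space :=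
  @SemiSimplicialSpace X
    (fun m n a ha => @sp_map X m n a (strictly_weakly ha))
    (fun m n a ha => @sp_map_continuous X m n a (strictly_weakly ha))
    (fun n h => @sp_map_id X n (strictly_weakly h))
    (fun l m n a b ha hb hab => @sp_map_comp X l m n a b (strictly_weakly ha)
       (strictly_weakly hb) (strictly_weakly hab)).

(* [lift i : 'I_k.+1 -> 'I_k.+2] is the coface map [k] -> [k+1] omitting i. *)
Lemma lift_strictly_increasing k (i : 'I_k.+2) :
  strictly_increasing (lift i : 'I_k.+1 -> 'I_k.+2).
Proof.
move=> a b ab /=; rewrite /bump.
by case: (leqP i a) => ia; case: (leqP i b) => ib; rewrite ?add0n ?add1n;
  lia.
Qed.

Definition face (Y : semi_simplicial_space) k (i : 'I_k.+2) :
    Y k.+1 -> Y k :=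
  ss_map (lift_strictly_increasing i).

Record semi_simplicial_map (Y Z : semi_simplicial_space) := SemiSimplicialMap {
  ssm_fun :> forall k, Y k -> Z k;
  ssm_continuous : forall k, continuous (@ssm_fun k);
  ssm_natural : forall m n (a : 'I_m.+1 -> 'I_n.+1)
    (ha : strictly_increasing a) (y : Y n),
    ssm_fun (ss_map ha y) = ss_map ha (ssm_fun y)
}.

Section product.
Variables Y Z : semi_simplicial_space.

Definition ss_prod_map m n (a : 'I_m.+1 -> 'I_n.+1)
    (ha : strictly_increasing a) (p : Y n * Z n) : Y m * Z m :=
  (ss_map ha p.1, ss_map ha p.2).

Lemma ss_prod_map_continuous m n (a : 'I_m.+1 -> 'I_n.+1)
  (ha : strictly_increasing a) : continuous (ss_prod_map ha).
Proof.
move=> p; apply: cvg_pair => /=.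
- by apply: continuous_comp; [exact: cvg_fst|exact: ss_map_continuous].
- by apply: continuous_comp; [exact: cvg_snd|exact: ss_map_continuous].
Qed.

Lemma ss_prod_map_id n (h : strictly_increasing (@id 'I_n.+1)) p :
  ss_prod_map h p = p.
Proof. by case: p => y z; rewrite /ss_prod_map !ss_map_id. Qed.

Lemma ss_prod_map_comp l m n (a : 'I_m.+1 -> 'I_n.+1)
    (b : 'I_l.+1 -> 'I_m.+1)
    (ha : strictly_increasing a) (hb : strictly_increasing b)
    (hab : strictly_increasing (a \o b)) p :
  ss_prod_map hab p = ss_prod_map hb (ss_prod_map ha p).
Proof. by congr pair; exact: ss_map_comp. Qed.

Definition ss_prod : semi_simplicial_space :=
  @SemiSimplicialSpace (fun k => (Y k * Z k)%type : topologicalType)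
    ss_prod_map ss_prod_map_continuous ss_prod_map_id ss_prod_map_comp.

Definition ss_fst : semi_simplicial_map ss_prod Y :=
  @SemiSimplicialMap ss_prod Y (fun _ => fst) (fun _ _ => cvg_fst)
    (fun _ _ _ _ _ => erefl).

End product.

Section increasing_sequences.

Definition incr_seq k : topologicalType :=
  discrete_topology
    (set_type [set f : 'I_k.+1 -> nat | {homo f : i j / (i < j)%N}]).

Lemma incr_seq_comp_subproof m n (a : 'I_m.+1 -> 'I_n.+1)
    (ha : strictly_increasing a) (f : incr_seq n) :
  (set_val f \o a) \in [set f : 'I_m.+1 -> nat | {homo f : i j / (i < j)%N}].
Proof.
apply/mem_set => i j ij /=.
by have /set_mem hf := valP f; apply: hf; exact: ha.
Qed.

Definition incr_seq_map m n (a : 'I_m.+1 -> 'I_n.+1)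
    (ha : strictly_increasing a) (f : incr_seq n) : incr_seq m :=
  exist _ (set_val f \o a) (incr_seq_comp_subproof ha f).

Lemma incr_seq_map_continuous m n (a : 'I_m.+1 -> 'I_n.+1)
  (ha : strictly_increasing a) : continuous (incr_seq_map ha).
Proof. by apply/continuousP => A _; exact: discrete_open. Qed.

Lemma incr_seq_map_id n (h : strictly_increasing (@id 'I_n.+1)) f :
  incr_seq_map h f = f.
Proof. exact: val_inj. Qed.

Lemma incr_seq_map_comp l m n (a : 'I_m.+1 -> 'I_n.+1)
    (b : 'I_l.+1 -> 'I_m.+1)
    (ha : strictly_increasing a) (hb : strictly_increasing b)
    (hab : strictly_increasing (a \o b)) f :
  incr_seq_map hab f = incr_seq_map hb (incr_seq_map ha f).
Proof. exact: val_inj. Qed.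

Definition incr : semi_simplicial_space :=
  SemiSimplicialSpace incr_seq_map_continuous incr_seq_map_id
    incr_seq_map_comp.

End increasing_sequences.

Section simplex.
Variable R : realType.

Definition simplex k : topologicalType :=
  set_type [set t : 'rV[R]_k.+1 |
    (forall i, 0 <= t 0 i) /\ \sum_i t 0 i = 1].

Definition coface_row k (i : 'I_k.+2) (t : 'rV[R]_k.+1) : 'rV[R]_k.+2 :=
  \row_j if unlift i j is Some l then t 0 l else 0.

Lemma coface_subproof k (i : 'I_k.+2) (t : simplex k) :
  coface_row i (set_val t) \in
    [set t : 'rV[R]_k.+2 | (forall i, 0 <= t 0 i) /\ \sum_i t 0 i = 1].
Proof.
have /set_mem[t0 t1] := valP t; apply/mem_set; split.
  by move=> j; rewrite mxE; case: unliftP.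
rewrite (bigD1 i)//= mxE unlift_none add0r.
rewrite (reindex_omap (lift i) (unlift i)) /=.
  apply: etrans t1; apply: eq_big => [l|l _].
    by rewrite eq_sym neq_lift liftK eqxx.
  by rewrite mxE liftK.
by move=> j; case: unliftP => [l -> //|->]; rewrite eqxx.
Qed.

Definition coface k (i : 'I_k.+2) (t : simplex k) : simplex k.+1 :=
  exist _ (coface_row i (set_val t)) (coface_subproof i t).

End simplex.

Section fat_realization.
Variables (R : realType) (Y : semi_simplicial_space).

Definition fat_piece k : topologicalType := (Y k * simplex R k)%type.
Definition fat_sum : topologicalType := {k & fat_piece k}.

Definition fat_point k (y : Y k) (t : simplex R k) : fat_sum :=
  existT fat_piece k (y, t).

Inductive fat_glue : fat_sum -> fat_sum -> Prop :=
  FatGlue k (i : 'I_k.+2) (y : Y k.+1) (t : simplex R k) :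
    fat_glue (fat_point (face i y) t) (fat_point y (coface i t)).

Definition fat_rel (p q : fat_sum) : bool :=
  `[< clos_refl_sym_trans fat_sum fat_glue p q >].

Lemma fat_rel_refl : reflexive fat_rel.
Proof. by move=> p; apply/asboolP; exact: rst_refl. Qed.

Lemma fat_rel_sym : symmetric fat_rel.
Proof. by move=> p q; apply/asboolP/asboolP; exact: rst_sym. Qed.

Lemma fat_rel_trans : transitive fat_rel.
Proof.
by move=> q p r /asboolP pq /asboolP qr; apply/asboolP; exact: rst_trans qr.
Qed.

Definition fat_equiv := EquivRel _ fat_rel_refl fat_rel_sym fat_rel_trans.

Definition fat_realization : topologicalType :=
  quotient_topology {eq_quot fat_equiv}.

Definition fat_proj (p : fat_sum) : fat_realization :=
  (\pi_({eq_quot fat_equiv}) p)%qT.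

Definition fat_repr (q : fat_realization) : fat_sum :=
  repr (q : {eq_quot fat_equiv}).

Lemma fat_proj_continuous : continuous fat_proj.
Proof. exact: pi_continuous. Qed.

Lemma fat_reprK q : fat_proj (fat_repr q) = q.
Proof. exact: reprK. Qed.

Lemma fat_projP p q :
  fat_proj p = fat_proj q <-> clos_refl_sym_trans fat_sum fat_glue p q.
Proof.
split=> [/eqmodP/asboolP //|pq]; apply/eqmodP; exact/asboolP.
Qed.

End fat_realization.

Lemma prod_map_continuous (A B D : topologicalType) (g : A -> B) :
  continuous g -> continuous (fun p : A * D => (g p.1, p.2)).
Proof.
move=> cg p; apply: cvg_pair => /=; last exact: cvg_snd.
by apply: continuous_comp; [exact: cvg_fst|exact: cg].
Qed.

Section fat_map.
Variables (R : realType) (Y Z : semi_simplicial_space).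
Variable f : semi_simplicial_map Y Z.

Definition fat_sum_map (p : fat_sum R Y) : fat_sum R Z :=
  fat_point (f _ (projT2 p).1) (projT2 p).2.

(* The map induced by f; see [fat_map_proj] for its value on classes. *)
Definition fat_map (q : fat_realization R Y) : fat_realization R Z :=
  fat_proj (fat_sum_map (fat_repr q)).

Lemma fat_map_proj (p : fat_sum R Y) :
  fat_map (fat_proj p) = fat_proj (fat_sum_map p).
Proof.
apply/fat_projP.
have : clos_refl_sym_trans _ (@fat_glue R Y) (fat_repr (fat_proj p)) p.
  by apply/fat_projP; rewrite fat_reprK.
move: (fat_repr _) => p'; elim=> [_ _ [k i y t]|q|q r _|q r s _ + _].
- apply: rst_step.
  have -> : fat_sum_map (fat_point (face i y) t) =
      fat_point (face i (f k.+1 y)) t.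
    by congr fat_point; exact: ssm_natural.
  exact: FatGlue.
- exact: rst_refl.
- exact: rst_sym.
- exact: rst_trans.
Qed.

Lemma fat_sum_map_continuous : continuous fat_sum_map.
Proof.
move=> [k p].
suff h : {for p, continuous
    (fun p : fat_piece R Y k => fat_point (f k p.1) p.2)}.
  by move=> U /h.
rewrite /fat_point.
apply: (@continuous_comp _ (fat_piece R Z k) _
  (fun p : fat_piece R Y k => (f k p.1, p.2) : fat_piece R Z k)).
  exact: (prod_map_continuous (@ssm_continuous _ _ f k)).
exact: existT_continuous.
Qed.

Lemma fat_map_continuous : continuous fat_map.
Proof.
apply/quotient_continuous.
rewrite (_ : _ \o _ = @fat_proj R Z \o fat_sum_map); last first.
  by apply/funext => p; exact: fat_map_proj.
move=> p; apply: continuous_comp; first exact: fat_sum_map_continuous.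
exact: fat_proj_continuous.
Qed.

End fat_map.

Record top_category := TopCategory {
  obj : topologicalType;
  mor : topologicalType;
  src : mor -> obj;
  tgt : mor -> obj;
  idm : obj -> mor;
  (* [comp e] is "first f, then g" *)
  comp : forall f g, tgt f = src g -> mor;
  src_continuous : continuous src;
  tgt_continuous : continuous tgt;
  idm_continuous : continuous idm;
  comp_continuous : continuous
    (fun p : set_type [set p : mor * mor | tgt p.1 = src p.2] =>
       comp (set_mem (valP p)));
  src_idm : forall x, src (idm x) = x;
  tgt_idm : forall x, tgt (idm x) = x;
  src_comp : forall f g (e : tgt f = src g), src (comp e) = src f;
  tgt_comp : forall f g (e : tgt f = src g), tgt (comp e) = tgt g;
  comp_idl : forall f (e : tgt (idm (src f)) = src f), comp e = f;
  comp_idr : forall f (e : tgt f = src (idm (tgt f))), comp e = f;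
  compA : forall f g h (fg : tgt f = src g) (gh : tgt g = src h)
    (fg_h : tgt (comp fg) = src h) (f_gh : tgt f = src (comp gh)),
    comp fg_h = comp f_gh
}.

Section nerve.
Variable C : top_category.
Implicit Types f g h : mor C.

(* [compt] extends composition by a junk value; it is used on composable pairs
   only. *)
Definition compt f g : mor C :=
  if @eqP _ (tgt f) (src g) is ReflectT e then comp e else f.

Lemma comptE f g (e : tgt f = src g) : compt f g = comp e.
Proof.
rewrite /compt; case: eqP => // e'; congr (comp _); exact: eq_irrelevance.
Qed.

Lemma src_compt f g : tgt f = src g -> src (compt f g) = src f.
Proof. by move=> e; rewrite (comptE e) src_comp. Qed.

Lemma tgt_compt f g : tgt f = src g -> tgt (compt f g) = tgt g.
Proof. by move=> e; rewrite (comptE e) tgt_comp. Qed.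

Lemma compt_idl x f : src f = x -> compt (idm x) f = f.
Proof.
move=> <-; have e : tgt (idm (src f)) = src f by rewrite tgt_idm.
by rewrite (comptE e) comp_idl.
Qed.

Lemma compt_idr x f : tgt f = x -> compt f (idm x) = f.
Proof.
move=> <-; have e : tgt f = src (idm (tgt f)) by rewrite src_idm.
by rewrite (comptE e) comp_idr.
Qed.

Lemma comptA f g h : tgt f = src g -> tgt g = src h ->
  compt (compt f g) h = compt f (compt g h).
Proof.
move=> fg gh; rewrite (comptE fg) (comptE gh).
have fg_h : tgt (comp fg) = src h by rewrite tgt_comp.
have f_gh : tgt f = src (comp gh) by rewrite src_comp.
by rewrite (comptE fg_h) (comptE f_gh); exact: compA.
Qed.

Lemma compt_continuous (X : topologicalType) (f g : X -> mor C) :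
  continuous f -> continuous g -> (forall x, tgt (f x) = src (g x)) ->
  continuous (fun x => compt (f x) (g x)).
Proof.
move=> cf cg e.
have fgP x : (f x, g x) \in [set p : mor C * mor C | tgt p.1 = src p.2].
  exact/mem_set/e.
pose fg x : set_type [set p : mor C * mor C | tgt p.1 = src p.2] :=
  exist _ (f x, g x) (fgP x).
have fg_cont : continuous fg.
  apply: continuous_comp_initial => x; apply: cvg_pair; [exact: cf|exact: cg].
rewrite (_ : (fun _ => _) = (fun p : set_type [set p : mor C * mor C |
  tgt p.1 = src p.2] => comp (set_mem (valP p))) \o fg); last first.
  by apply/funext => x; exact: comptE.
move=> x; apply: continuous_comp; [exact: fg_cont|exact: comp_continuous].
Qed.

(* Composable k-tuples, with the subspace topology of M(C)^k. *)
Definition composable k (x : 'I_k -> mor C) :=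
  forall i j : 'I_k, j = i.+1 :> nat -> tgt (x i) = src (x j).

Definition chain k : topologicalType :=
  set_type [set x : prod_topology (fun _ : 'I_k => mor C) | composable x].

Definition nerve_space k : topologicalType :=
  if k is 0 then obj C else chain k.

Definition edge k : nerve_space k -> 'I_k -> mor C :=
  match k with
  | 0 => fun _ i => False_rect _ (notF (ltn_ord i))
  | k'.+1 => fun x i => set_val x i
  end.

Definition vertex k : nerve_space k -> 'I_k.+1 -> obj C :=
  match k with
  | 0 => fun x _ => x
  | k'.+1 => fun x i =>
      if unlift ord0 i is Some j then tgt (set_val x j)
      else src (set_val x ord0)
  end.

Definition ord_fst k (i : 'I_k) : 'I_k.+1 := widen_ord (leqnSn k) i.
Definition ord_snd k (i : 'I_k) : 'I_k.+1 := lift ord0 i.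

(* The composite x_i, ..., x_(j-1) of the edges between the i-th and the j-th
   vertex, for i <= j. *)
Definition arrow k (x : nerve_space k) (i j : 'I_k.+1) : mor C :=
  foldl compt (idm (vertex x i))
    [seq edge x l | l : 'I_k <- enum 'I_k & (i <= l < j)%N].

Lemma src_edge k (x : nerve_space k) l : src (edge x l) = vertex x (ord_fst l).
Proof.
case: k x l => [_ []//|k] x l /=.
case: unliftP => [j lj|l0].
  have /set_mem hx := valP x; symmetry; apply: hx.
  by have /= := congr1 val lj; rewrite /bump add1n.
by congr (src (_ x _)); apply: val_inj; have /= := congr1 val l0.
Qed.

Lemma tgt_edge k (x : nerve_space k) l : tgt (edge x l) = vertex x (ord_snd l).
Proof. by case: k x l => [_ []//|k] x l /=; rewrite liftK. Qed.

Lemma arrow_id k (x : nerve_space k) i : arrow x i i = idm (vertex x i).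
Proof.
rewrite /arrow (_ : [seq l <- _ | _] = [::])//.
by apply/eqP; rewrite -size_eq0 size_filter eqn0Ngt -has_count; apply/hasPn => l _; lia.
Qed.

Lemma arrow_snd k (x : nerve_space k) (i : 'I_k.+1) (l : 'I_k) : (i <= l)%N ->
  arrow x i (ord_snd l) = compt (arrow x i (ord_fst l)) (edge x l).
Proof.
move=> il; rewrite /arrow -foldl_rcons -map_rcons; congr foldl; congr map.
apply: (inj_map val_inj); rewrite map_rcons.
have filterE (j : nat) : [seq val m | m : 'I_k <- enum 'I_k & (i <= m < j)%N] =
    [seq m <- iota 0 k | (i <= m < j)%N].
  by rewrite -val_enum_ord filter_map.
rewrite !filterE /= /bump add1n.
rewrite (_ : iota 0 k = iota 0 l ++ nat_of_ord l :: iota l.+1 (k - l.+1));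
  last by rewrite -[_ :: _]/(iota l (k - l.+1).+1) -iotaD; congr iota;
    have := ltn_ord l; lia.
rewrite !filter_cat /= il ltnn ltnSn -cats1.
have tail0 j : (j <= l.+1)%N ->
    [seq m <- iota l.+1 (k - l.+1) | (i <= m < j)%N] = [::].
  move=> jl; rewrite -[RHS](filter_pred0 (iota l.+1 (k - l.+1))).
  by apply: eq_in_filter => m; rewrite mem_iota /=; lia.
rewrite !tail0// cats0; congr cat.
by apply: eq_in_filter => m; rewrite mem_iota; lia.
Qed.

(* Induction on the upper end of an interval of vertices. *)
Lemma ord_ind_from k (i : 'I_k.+1) (P : 'I_k.+1 -> Prop) :
  P i ->
  (forall l : 'I_k, (i <= l)%N -> P (ord_fst l) -> P (ord_snd l)) ->
  forall j : 'I_k.+1, (i <= j)%N -> P j.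
Proof.
move=> Pi PS [j jk]; elim: j jk => [|j IH] jk ij.
  by rewrite (_ : Ordinal jk = i)//; apply: val_inj => /=; move: ij => /=; lia.
case: (eqVneq (nat_of_ord i) j.+1) => [ij1|ij1].
  by rewrite (_ : Ordinal jk = i)//; exact: val_inj.
have jk' : (j < k)%N by [].
rewrite (_ : Ordinal jk = ord_snd (Ordinal jk')); last exact: val_inj.
have {}ij : (i <= j)%N by move: ij ij1 => /=; lia.
apply: PS => //.
rewrite (_ : ord_fst _ = Ordinal (leq_trans jk' (leqnSn k))); last exact: val_inj.
exact: IH.
Qed.

Lemma arrow_ends k (x : nerve_space k) (i j : 'I_k.+1) : (i <= j)%N ->
  src (arrow x i j) = vertex x i /\ tgt (arrow x i j) = vertex x j.
Proof.
elim/ord_ind_from => [|l il [s t]].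
  by rewrite arrow_id src_idm tgt_idm.
have e : tgt (arrow x i (ord_fst l)) = src (edge x l) by rewrite src_edge.
by rewrite arrow_snd// src_compt// tgt_compt// tgt_edge.
Qed.

Lemma src_arrow k (x : nerve_space k) (i j : 'I_k.+1) : (i <= j)%N ->
  src (arrow x i j) = vertex x i.
Proof. by case/(arrow_ends x). Qed.

Lemma tgt_arrow k (x : nerve_space k) (i j : 'I_k.+1) : (i <= j)%N ->
  tgt (arrow x i j) = vertex x j.
Proof. by case/(arrow_ends x). Qed.

Lemma arrow_comp k (x : nerve_space k) (i j l : 'I_k.+1) : (i <= j)%N -> (j <= l)%N ->
  compt (arrow x i j) (arrow x j l) = arrow x i l.
Proof.
move=> ij; elim/ord_ind_from => [|m jm IH].
  by rewrite arrow_id compt_idr// tgt_arrow.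
have im := leq_trans ij jm.
rewrite !arrow_snd// -IH comptA//; last by rewrite tgt_arrow// src_edge.
by rewrite tgt_arrow// src_arrow.
Qed.

Lemma arrow_edge k (x : nerve_space k) l :
  arrow x (ord_fst l) (ord_snd l) = edge x l.
Proof. by rewrite arrow_snd// arrow_id compt_idl// src_edge. Qed.

Lemma edge_continuous k i : continuous (fun x : nerve_space k => edge x i).
Proof.
case: k i => [[]//|k] i x.
apply: (@continuous_comp _ (prod_topology (fun _ : 'I_k.+1 => mor C)) _
  set_val (proj i)); [exact: initial_continuous|exact: proj_continuous].
Qed.

Lemma vertex_continuous k i : continuous (fun x : nerve_space k => vertex x i).
Proof.
case: k i => [|k] i; first by move=> x; exact: cvg_id.
move=> x /=; case: unliftP => [j _|_].
  by apply: continuous_comp;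
    [exact: (@edge_continuous k.+1)|exact: tgt_continuous].
by apply: continuous_comp;
  [exact: (@edge_continuous k.+1)|exact: src_continuous].
Qed.

Lemma arrow_continuous k (i j : 'I_k.+1) : (i <= j)%N ->
  continuous (fun x : nerve_space k => arrow x i j).
Proof.
elim/ord_ind_from => [|l il IH].
  rewrite (_ : (fun _ => _) = @idm C \o (fun x : nerve_space k => vertex x i)).
    move=> x; apply: continuous_comp; first exact: vertex_continuous.
    exact: idm_continuous.
  by apply/funext => x /=; rewrite arrow_id.
under eq_fun do rewrite arrow_snd//.
apply: compt_continuous => //; first exact: edge_continuous.
by move=> x; rewrite tgt_arrow// src_edge.
Qed.

Lemma nerve_ext k (x y : nerve_space k) :
  vertex x =1 vertex y -> edge x =1 edge y -> x = y.
Proof.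
case: k x y => [|k] x y v e; first exact: (v ord0).
by apply: val_inj; apply/funext => i; exact: (e i).
Qed.

Section nerve_map.
Variables (m n : nat) (a : 'I_m.+1 -> 'I_n.+1) (ha : weakly_increasing a).

Let aS l : (a (ord_fst l) <= a (ord_snd l))%N.
Proof. by apply: ha => /=; rewrite /bump add1n. Qed.

Lemma nerve_map_subproof (x : nerve_space n) :
  (fun l => arrow x (a (ord_fst l)) (a (ord_snd l))) \in
    [set x : prod_topology (fun _ : 'I_m => mor C) | composable x].
Proof.
apply/mem_set => i j ij /=; rewrite tgt_arrow// src_arrow//.
by congr (vertex x (a _)); apply: val_inj; rewrite /= ij.
Qed.

End nerve_map.

(* Ner_k C is the space of functors [k] -> C, encoded by their values on the
   morphisms l -> l+1; the simplicial structure is precomposition. *)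
Definition nerve_map m n (a : 'I_m.+1 -> 'I_n.+1)
    : weakly_increasing a -> nerve_space n -> nerve_space m :=
  match m return forall a : 'I_m.+1 -> 'I_n.+1,
    weakly_increasing a -> nerve_space n -> nerve_space m with
  | 0 => fun a _ x => vertex x (a ord0)
  | m'.+1 => fun a ha x =>
      exist _ (fun l => arrow x (a (ord_fst l)) (a (ord_snd l)))
        (nerve_map_subproof ha x)
  end a.

Lemma edge_nerve_map m n (a : 'I_m.+1 -> 'I_n.+1) (ha : weakly_increasing a) x
  l : edge (nerve_map ha x) l = arrow x (a (ord_fst l)) (a (ord_snd l)).
Proof. by case: m a ha l => [a ha []|]. Qed.

Lemma vertex_nerve_map m n (a : 'I_m.+1 -> 'I_n.+1) (ha : weakly_increasing a)
  x i : vertex (nerve_map ha x) i = vertex x (a i).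
Proof.
case: m a ha i => [|m] a ha i; first by rewrite /= (ord1 i).
rewrite /=; case: unliftP => [j ->|->].
  by rewrite set_valE /= tgt_arrow//; apply: ha => /=; rewrite /bump add1n.
rewrite set_valE /= src_arrow; last by apply: ha.
by congr (vertex x (a _)); exact: val_inj.
Qed.

Lemma arrow_nerve_map m n (a : 'I_m.+1 -> 'I_n.+1) (ha : weakly_increasing a)
  x (i j : 'I_m.+1) :
  (i <= j)%N -> arrow (nerve_map ha x) i j = arrow x (a i) (a j).
Proof.
elim/ord_ind_from => [|l il IH].
  by rewrite !arrow_id vertex_nerve_map.
rewrite arrow_snd// IH edge_nerve_map arrow_comp//; exact: (ha).
Qed.

Lemma nerve_map_continuous m n (a : 'I_m.+1 -> 'I_n.+1)
  (ha : weakly_increasing a) : continuous (nerve_map ha).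
Proof.
case: m a ha => [|m] a ha; first exact: vertex_continuous.
apply: continuous_comp_initial => x; apply/cvg_sup => i.
move: x; apply: continuous_comp_initial.
apply: arrow_continuous; apply: ha => /=; by rewrite /bump add1n.
Qed.

Lemma nerve_map_id n (h : weakly_increasing (@id 'I_n.+1)) x :
  nerve_map h x = x.
Proof.
by apply: nerve_ext => i; rewrite ?vertex_nerve_map// edge_nerve_map arrow_edge.
Qed.

Lemma nerve_map_comp l m n (a : 'I_m.+1 -> 'I_n.+1) (b : 'I_l.+1 -> 'I_m.+1)
    (ha : weakly_increasing a) (hb : weakly_increasing b)
    (hab : weakly_increasing (a \o b)) x :
  nerve_map hab x = nerve_map hb (nerve_map ha x).
Proof.
apply: nerve_ext => i; rewrite ?vertex_nerve_map// !edge_nerve_map.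
by rewrite arrow_nerve_map//; apply: hb => /=; rewrite /bump add1n.
Qed.

Definition nerve : simplicial_space :=
  SimplicialSpace nerve_map_continuous nerve_map_id nerve_map_comp.

(* The faces of the nerve are the usual ones: target and source on Ner_1, and
   on Ner_k+1 with k > 0, d_0 and d_(k+1) drop the first and the last morphism
   and the other d_i compose the morphisms with indices i-1 and i. *)
Lemma nerve_face1 (x : nerve 1) :
  face (Y := underlying nerve) ord0 x = tgt (edge x ord0) /\
  face (Y := underlying nerve) ord_max x = src (edge x ord0).
Proof.
rewrite src_edge tgt_edge; split.
  by congr (vertex x _); exact: val_inj.
by congr (vertex x _); exact: val_inj.
Qed.

Lemma nerve_face k (i : 'I_k.+2) (x : nerve k.+1) (l : 'I_k) :
  edge (face (Y := underlying nerve) i x : nerve k) l =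
  if (l.+1 < i)%N then edge x (ord_fst l)
  else if l.+1 == i then compt (edge x (ord_fst l)) (edge x (ord_snd l))
  else edge x (ord_snd l).
Proof.
have fs (m : 'I_k) : ord_fst (ord_snd m) = ord_snd (ord_fst m).
  exact: val_inj.
rewrite edge_nerve_map; case: ifPn => [li|].
  rewrite -arrow_edge; congr arrow; apply: val_inj; rewrite /= /bump; lia.
rewrite -leqNgt => il; case: ifPn => [/eqP li|li].
  rewrite -[edge x (ord_fst l)]arrow_edge -fs -arrow_snd; last first.
    by rewrite /= /bump; lia.
  by congr arrow; apply: val_inj; rewrite /= /bump; lia.
rewrite -arrow_edge; congr arrow; apply: val_inj; rewrite /= /bump; lia.
Qed.

End nerve.

(* Main.v *)
Require Import Defs.
From Stdlib Require Import Relation_Operators.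
From mathcomp Require Import all_boot all_order all_algebra.
From mathcomp Require Import all_classical all_reals all_analysis.
From mathcomp Require Import lra zify.

(** The projection has an explicit homotopy inverse, defined for every
    simplicial space X, by barycentric subdivision.

    Let x be a k-simplex of X. A flag F_0 < ... < F_n of nonempty sets of
    vertices of x gives the weakly increasing sequence max F_0, ..., max F_n,
    hence an n-simplex of X obtained from x, possibly degenerate, and the
    strictly increasing cardinalities #|F_0|, ..., #|F_n|, which serve as colours
    of this n-simplex. A point t of x lies on the flag of its superlevel sets, and
    taking the differences of successive values of t as weights, normalised to
    total mass 1, one obtains a map g from the realization of X to that of X times
    [incr]. It respects the faces of x, since the flag of t, its colours and its
    weights involve only the vertices at which t is positive.

    Both composites of g with the projection are homotopic to the identity by a
    formula which subdivides a prism. A simplex x with vertex colours f has a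
    second coloured subdivision, in which F has the colour f (max F) + #|F| + 1.
    This colour is larger than the colours of the vertices in F, so vertices
    v_0 < ... < v_m contained in F_0, followed by the flag F_0 < ... < F_n, form a
    simplex of X times [incr]: this is a homotopy from the identity to the second
    subdivision. As #|F| < f (max F) + #|F| + 1, each flag of the first subdivision
    may be followed by a flag of larger or equal sets of the second one: this is a
    homotopy from the second subdivision to the first one, the latter being g
    after the projection. Forgetting the colours, which then may be chosen
    arbitrarily, the same formula gives a homotopy from the identity of the
    realization of X to the projection after g.

    All these maps send a parameter to the point with certain weights on the nodes
    (vertices and sets of vertices) of a chain. Such a map is continuous as soon
    as the weights are ([weighted_point_continuous]), and the weights are
    continuous functions of t and of the time ([weight_continuous]) whose support
    is always a chain ([weight_admissible]). Compatibility with faces is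
    [sd_point_face], and the homotopies descend to the realizations by
    [fat_realization_homotopy]. *)

Set Implicit Arguments.
Unset Strict Implicit.
Unset Printing Implicit Defensive.

Import Order.TTheory GRing.Theory Num.Theory.
Import numFieldNormedType.Exports.

Local Open Scope classical_set_scope.
Local Open Scope ring_scope.

(** * Continuous real functions and maps into simplices *)

Section real_functions.
Variables (R : realType) (Z : topologicalType).
Implicit Types f g : Z -> R.

Lemma continuous_minr f g : continuous f -> continuous g ->
  continuous (fun z => Num.min (f z) (g z)).
Proof. by move=> cf cg z; apply: continuous_min; [exact: cf|exact: cg]. Qed.

Lemma continuous_maxr f g : continuous f -> continuous g ->
  continuous (fun z => Num.max (f z) (g z)).
Proof. by move=> cf cg z; apply: continuous_max; [exact: cf|exact: cg]. Qed.

Lemma continuous_addr f g : continuous f -> continuous g ->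
  continuous (fun z => f z + g z).
Proof. by move=> cf cg z; apply: continuousD; [exact: cf|exact: cg]. Qed.

Lemma continuous_subr f g : continuous f -> continuous g ->
  continuous (fun z => f z - g z).
Proof. by move=> cf cg z; apply: continuousB; [exact: cf|exact: cg]. Qed.

Lemma continuous_mulr f g : continuous f -> continuous g ->
  continuous (fun z => f z * g z).
Proof. by move=> cf cg z; apply: cvgM; [exact: cf|exact: cg]. Qed.

Lemma continuous_divr f g : (forall z, g z != 0) ->
  continuous f -> continuous g -> continuous (fun z => f z / g z).
Proof.
move=> g0 cf cg z; apply: cvgM; first exact: cf.
by apply: cvgV; [exact: g0|exact: cg].
Qed.

Lemma continuous_sumr (I : finType) (P : pred I) (f : I -> Z -> R) :
  (forall i, continuous (f i)) -> continuous (fun z => \sum_(i | P i) f i z).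
Proof. by move=> cf; apply: continuous_big => //; exact: add_continuous. Qed.

Lemma continuous_bigminr (I : finType) (P : pred I) (c : R) (f : I -> Z -> R) :
  (forall i, continuous (f i)) ->
  continuous (fun z => \big[Num.min/c]_(i | P i) f i z).
Proof.
move=> cf; apply: continuous_big => // p.
by apply: continuous_min; [exact: cvg_fst|exact: cvg_snd].
Qed.

Lemma continuous_row n (u : Z -> 'I_n -> R) :
  (forall i, continuous (u^~ i)) ->
  continuous (fun z => \row_i u z i : 'rV[R]_n).
Proof.
move=> cu z A [P Pz PA].
have : \forall y \near z, forall i j, P i j (u y j).
  apply: filter_forall => i; apply: filter_forall => j.
  by have := Pz i j; rewrite mxE => /(cu j z).
by apply: filterS => y Py; apply: PA => i j; rewrite mxE.
Qed.

End real_functions.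

Lemma continuous_pair (Z A B : topologicalType) (f : Z -> A) (g : Z -> B) :
  continuous f -> continuous g -> continuous (fun z => (f z, g z)).
Proof.
by move=> cf cg z; apply: cvg_pair => /=; [exact: cf|exact: cg].
Qed.

Section simplex_retraction.
Variable R : realType.

(** The i-th barycentric coordinate of a point of the standard simplex. *)
Definition bary n (t : simplex R n) (i : 'I_n.+1) : R := set_val t 0 i.

Lemma simplex_ge0 n (t : simplex R n) i : 0 <= bary t i.
Proof. by have [h0 h1] := set_mem (valP t); rewrite ?h0. Qed.

Lemma simplex_sum n (t : simplex R n) : \sum_i bary t i = 1.
Proof. by have [h0 h1] := set_mem (valP t); rewrite ?h0. Qed.

Lemma simplex_le1 n (t : simplex R n) i : bary t i <= 1.
Proof.
rewrite -[leRHS](simplex_sum t) (bigD1 i)//= lerDl; apply: sumr_ge0 => j _.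
exact: simplex_ge0.
Qed.

Lemma simplex_coord_continuous n i :
  continuous (fun t : simplex R n => bary t i).
Proof.
move=> t; apply: (@continuous_comp _ _ _ set_val (fun v : 'rV[R]_n.+1 => v 0 i)).
  exact: initial_continuous.
exact: coord_continuous.
Qed.

(** The row of coordinates of [retr] below: negative entries are cut off, the
    mass missing to total mass 1 is put on the vertex 0, and the result is
    divided by its sum, which equals the maximum of 1 and the cut-off sum. *)
Definition retr_row n (u : 'I_n.+1 -> R) : 'rV[R]_n.+1 :=
  let s := \sum_i Num.max 0 (u i) in
  \row_i ((Num.max 0 (u i) + (if i == ord0 then Num.max 0 (1 - s) else 0))
    / Num.max 1 s).

Lemma retr_row_subproof n (u : 'I_n.+1 -> R) :
  retr_row u \in
    [set t : 'rV[R]_n.+1 | (forall i, 0 <= t 0 i) /\ \sum_i t 0 i = 1].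
Proof.
apply/mem_set; rewrite /retr_row; set s := \sum_i _; split=> [i|].
  rewrite mxE; apply: divr_ge0; last by rewrite le_max ler01.
  by apply: addr_ge0; [|case: eqP => // _]; rewrite le_max lexx.
under eq_bigr do rewrite mxE.
rewrite -mulr_suml big_split -/s -big_mkcond big_pred1_eq /=.
have [s1|s1] := leP 1 s.
  by rewrite max_l ?subr_le0// addr0 divff//; apply: lt0r_neq0; lra.
by rewrite max_r ?subr_ge0 ?(ltW s1)// divr1; lra.
Qed.

(** A retraction of the space of all families of reals onto the simplex. It
    gives continuous simplex-valued maps without a proof that the coordinates
    are barycentric at every parameter; only its values on barycentric families
    matter. *)
Definition retr n (u : 'I_n.+1 -> R) : simplex R n :=
  exist _ (retr_row u) (retr_row_subproof u).

Lemma retrE n (u : 'I_n.+1 -> R) i : (forall i, 0 <= u i) -> \sum_i u i = 1 ->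
  bary (retr u) i = u i.
Proof.
move=> u0 u1; rewrite /bary set_valE /= mxE.
under eq_bigr do rewrite max_r//.
by rewrite u1 subrr !maxxx divr1 max_r// if_same addr0.
Qed.

Lemma retr_continuous (Z : topologicalType) n (u : Z -> 'I_n.+1 -> R) :
  (forall i, continuous (u^~ i)) -> continuous (fun z => retr (u z)).
Proof.
move=> cu; apply: continuous_comp_initial.
have cmax i : continuous (fun z => Num.max 0 (u z i)).
  by apply: continuous_maxr => //; exact: cst_continuous.
have csum : continuous (fun z => \sum_i Num.max 0 (u z i)).
  exact: continuous_sumr.
apply: continuous_row => i; apply: continuous_divr => [z||].
- by apply: lt0r_neq0; rewrite lt_max ltr01.
- apply: continuous_addr => //; case: eqP => _; last exact: cst_continuous.
  apply: continuous_maxr; first exact: cst_continuous.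
  by apply: continuous_subr => //; exact: cst_continuous.
- by apply: continuous_maxr => //; exact: cst_continuous.
Qed.

Lemma simplex_eq n (t t' : simplex R n) :
  (forall i, bary t i = bary t' i) -> t = t'.
Proof.
move=> e; apply: val_inj; apply/rowP => i; exact: e.
Qed.

Lemma retr_simplex n (t : simplex R n) : retr (bary t) = t.
Proof.
by apply: simplex_eq => i; rewrite retrE//;
  [move=> j; exact: simplex_ge0|exact: simplex_sum].
Qed.

End simplex_retraction.

(** * Faces in the fat realization *)

Lemma strictly_increasing_ge m n (b : 'I_m.+1 -> 'I_n.+1) (i : 'I_m.+1) :
  strictly_increasing b -> (i <= b i)%N.
Proof.
move=> hb; case: i => i; elim: i => [//|i IH] im.
have im' : (i < m.+1)%N by lia.
have /= := hb (Ordinal im') (Ordinal im) (ltnSn i).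
by have /= := IH im'; lia.
Qed.

Lemma strictly_increasing_id n (b : 'I_n.+1 -> 'I_n.+1) :
  strictly_increasing b -> b = id.
Proof.
move=> hb; apply/funext => i; apply: val_inj => /=.
have hb' : strictly_increasing (@rev_ord _ \o b \o @rev_ord _).
  move=> p q pq /=.
  have /= := hb (rev_ord q) (rev_ord p).
  have := ltn_ord (b (rev_ord q)); have := ltn_ord (b (rev_ord p)).
  by have := ltn_ord q; lia.
have := strictly_increasing_ge i hb.
have /= := strictly_increasing_ge (rev_ord i) hb'.
by rewrite rev_ordK; have := ltn_ord (b i); have := ltn_ord i; lia.
Qed.

Lemma strictly_increasing_neq m n (b : 'I_m.+1 -> 'I_n.+1) (i j : 'I_m.+1) :
  strictly_increasing b -> i != j -> b i != b j.
Proof.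
by move=> hb; rewrite -!val_eqE /= !neq_ltn => /orP[/hb ->|/hb ->];
  rewrite ?orbT.
Qed.

Lemma strictly_increasing_surj m n (b : 'I_m.+1 -> 'I_n.+1) :
  strictly_increasing b -> (forall j, exists i, j = b i) -> m = n.
Proof.
move=> hb surj.
have b_inj : injective b.
  by move=> p q; apply: contra_eq; exact: strictly_increasing_neq.
pose c j := sval (cid (surj j)).
have cK j : j = b (c j) by rewrite /c; case: cid.
have c_inj : injective c by move=> p q pq; rewrite (cK p) (cK q) pq.
apply/eqP; rewrite eqn_leq.
have := leq_card b b_inj; have := leq_card c c_inj.
by rewrite !card_ord !ltnS => -> ->.
Qed.

Lemma sum_codom (R : realType) (I J : finType) (e : I -> J) (w : J -> R) :
  injective e -> (forall j, w j != 0 -> exists i, j = e i) ->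
  \sum_j w j = \sum_i w (e i).
Proof.
move=> inj_e cov.
rewrite (bigID [in [set e i | i : I]%SET]) /= [X in _ + X]big1 ?addr0.
  by rewrite big_imset//= => i i' _ _; exact: inj_e.
move=> j /negP je; apply/eqP/negPn/negP => /cov[i ji].
by apply: je; rewrite ji imset_f.
Qed.

Section glue.
Variables (R : realType) (Y : semi_simplicial_space).

Lemma bary_coface k (i : 'I_k.+2) (t : simplex R k) j :
  bary (coface i t) j = if unlift i j is Some l then bary t l else 0.
Proof. by rewrite /bary set_valE /= mxE. Qed.

Lemma fat_proj_face k (i : 'I_k.+2) (y : Y k.+1) (t : simplex R k) :
  fat_proj (fat_point y (coface i t)) = fat_proj (fat_point (face i y) t).
Proof. by apply/fat_projP/rst_sym/rst_step; exact: FatGlue. Qed.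

Let fat_proj_restrict_surj m n (b : 'I_m.+1 -> 'I_n.+1)
    (hb : strictly_increasing b) (y : Y n) (t : simplex R n) :
  (forall j, exists i, j = b i) ->
  fat_proj (fat_point y t) =
    fat_proj (fat_point (ss_map hb y) (retr (bary t \o b))).
Proof.
move=> /(strictly_increasing_surj hb) mn; subst m.
have bid := strictly_increasing_id hb; subst b.
by rewrite ss_map_id retr_simplex.
Qed.

(** The gluing relation is generated by the codimension one faces; here it is
    extended to all faces: a point of a simplex that lies on the face spanned by
    the image of b may be restricted along b. *)
Lemma fat_proj_restrict m n (b : 'I_m.+1 -> 'I_n.+1)
    (hb : strictly_increasing b) (y : Y n) (t : simplex R n) :
  (forall j, bary t j != 0 -> exists i, j = b i) ->
  fat_proj (fat_point y t) =
    fat_proj (fat_point (ss_map hb y) (retr (bary t \o b))).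
Proof.
elim: n => [|n IH] in b hb y t *; move=> tb;
    have [surj|/existsNP[i ib]] := pselect (forall j, exists i, j = b i).
- exact: fat_proj_restrict_surj.
- by exfalso; apply: ib; exists ord0; rewrite [i]ord1 [RHS]ord1.
- exact: fat_proj_restrict_surj.
(* The vertex i is omitted by b, so b factors as [lift i \o b']. *)
- have ib' l : i != b l by apply/eqP => il; apply: ib; exists l.
  pose b' l := odflt ord0 (unlift i (b l)).
  have b'K l : lift i (b' l) = b l.
    by rewrite /b'; case: unliftP (ib' l) => [//|<-]; rewrite eqxx.
  have eb : b = lift i \o b' by apply/funext => l /=; rewrite b'K.
  have hb' : strictly_increasing b'.
    move=> p q /hb; rewrite -!b'K /= /bump.
    by case: leqP; case: leqP; lia.
  have ti : bary t i = 0.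
    by apply/eqP/negPn/negP => /tb[l]; apply/eqP.
  have s1 : \sum_j bary t (lift i j) = 1.
    rewrite -(simplex_sum t) [RHS](@sum_codom _ _ _ (lift i)) //.
      exact: lift_inj.
    move=> j; case: (unliftP i j) => [l -> _|->]; first by exists l.
    by rewrite ti eqxx.
  have tE l : bary (retr (bary t \o lift i)) l = bary t (lift i l).
    by rewrite retrE// => j; exact: simplex_ge0.
  have -> : t = coface i (retr (bary t \o lift i)).
    apply: simplex_eq => j; rewrite bary_coface.
    by case: unliftP => [l ->|->]; rewrite ?tE.
  rewrite fat_proj_face (IH b' hb'); last first.
    move=> j; rewrite tE => /tb[l]; rewrite -b'K => /lift_inj ->.
    by exists l.
  congr (fat_proj (fat_point _ (retr _))).
    move: hb; rewrite eb => hb; exact/esym/ss_map_comp.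
  apply/funext => l /=; rewrite tE bary_coface b'K -b'K liftK.
  by rewrite tE.
Qed.

End glue.

Section total_maps.

(** Replaces a map that is not weakly increasing by a constant one. *)
Definition clamp_weak m n (a : 'I_m.+1 -> 'I_n.+1) : 'I_m.+1 -> 'I_n.+1 :=
  if `[< weakly_increasing a >] then a else fun _ => ord0.

Lemma clamp_weakP m n (a : 'I_m.+1 -> 'I_n.+1) :
  weakly_increasing (clamp_weak a).
Proof. by rewrite /clamp_weak; case: asboolP. Qed.

(** Pullback along an arbitrary map of vertices, with the junk map of
    [clamp_weak] when the map is not weakly increasing. *)
Definition smap (X : simplicial_space) m n (a : 'I_m.+1 -> 'I_n.+1) :
  X n -> X m := sp_map (clamp_weakP a).

Lemma smapE (X : simplicial_space) m n (a : 'I_m.+1 -> 'I_n.+1)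
  (ha : weakly_increasing a) : smap (X := X) a = sp_map ha.
Proof.
rewrite /smap; move: (clamp_weakP a); rewrite /clamp_weak asboolT// => h.
by congr sp_map; exact: Prop_irrelevance.
Qed.

(** Replaces a map that is not strictly increasing by the inclusion. *)
Definition clamp_strict m (c : 'I_m.+1 -> nat) : 'I_m.+1 -> nat :=
  if `[< {homo c : i j / (i < j)%N} >] then c else @nat_of_ord _.

Lemma clamp_strictP m (c : 'I_m.+1 -> nat) :
  clamp_strict c \in [set f : 'I_m.+1 -> nat | {homo f : i j / (i < j)%N}].
Proof. by apply/mem_set; rewrite /clamp_strict; case: asboolP => /= [hc|_]. Qed.

(** The simplex of [incr] with vertices c, for c strictly increasing. *)
Definition colours m (c : 'I_m.+1 -> nat) : incr_seq m :=
  exist _ (clamp_strict c) (clamp_strictP c).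

Lemma val_colours m (c : 'I_m.+1 -> nat) : {homo c : i j / (i < j)%N} ->
  set_val (colours c) = c.
Proof. by move=> hc; rewrite set_valE /= /clamp_strict; case: asboolP. Qed.

End total_maps.

(** * Points of the realization given by weights on a chain *)

Section chains.
(* E is a finite set of nodes with a relation rho (not assumed transitive), and
   e0 serves as default value only. A node e carries a vertex [last e] of the
   standard k-simplex and a colour [col e]. *)
Variables (R : realType) (E : finType) (e0 : E) (rho : rel E) (k : nat).
Variables (last : E -> 'I_k.+1) (col : E -> nat).

(** Along rho, vertices increase weakly and colours increase strictly; so a
    simplex x of X and a rho-chain of n+1 nodes determine an n-simplex of the
    product of X with [incr]. *)
Definition labelling := forall e e', rho e e' ->
  (last e <= last e')%N /\ (col e < col e')%N.

(** Weights of total mass 1 whose support is totally ordered by rho: a point of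
    the order complex of the nodes. *)
Definition admissible (w : E -> R) :=
  [/\ forall e, 0 <= w e, \sum_e w e = 1 &
      forall e e', w e != 0 -> w e' != 0 -> e != e' -> rho e e' || rho e' e].

(** A finite sequence of nodes, increasing for rho between any two positions. *)
Definition chain_of n (c : 'I_n.+1 -> E) :=
  forall i j : 'I_n.+1, (i < j)%N -> rho (c i) (c j).

Definition covers n (c : 'I_n.+1 -> E) (w : E -> R) :=
  forall e, w e != 0 -> exists i, e = c i.

(** The elements of S in the order of their colours. *)
Definition sorted_support (S : {set E}) : seq E := sort (relpre col leq) (enum S).

(** The sequence [sorted_support S] as a function; for nonempty S, which is the
    only case of interest, it lists S without repetition. *)
Definition listing (S : {set E}) (i : 'I_(size (sorted_support S)).-1.+1) : E :=
  nth e0 (sorted_support S) i.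

Definition support_of (w : E -> R) : {set E} := [set e | w e != 0]%SET.

Lemma mem_sorted_support S : sorted_support S =i S.
Proof. by move=> e; rewrite mem_sort mem_enum. Qed.

Lemma covers_listing (S : {set E}) w :
  (forall e, w e != 0 -> e \in S) -> covers (listing (S := S)) w.
Proof.
move=> wS e /wS; rewrite -mem_sorted_support => eS.
have i_lt : (index e (sorted_support S) < (size (sorted_support S)).-1.+1)%N.
  by apply: leq_trans (leqSpred _); rewrite index_mem.
by exists (Ordinal i_lt); rewrite /listing nth_index.
Qed.

Lemma size_sorted_support w : admissible w ->
  (0 < size (sorted_support (support_of w)))%N.
Proof.
case=> _ w1 _; rewrite lt0n; apply/negP => /nilP s0.
have /eqP := w1; rewrite big1 ?(eq_sym 0) ?oner_eq0// => e _.
apply/eqP/negPn/negP => we.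
have : e \in sorted_support (support_of w) by rewrite mem_sorted_support inE.
by rewrite s0.
Qed.

Lemma listing_support w i : admissible w ->
  w (listing (S := support_of w) i) != 0.
Proof.
move=> aw; have s0 := size_sorted_support aw.
have : listing i \in sorted_support (support_of w).
  by rewrite mem_nth// (leq_trans (ltn_ord i))// prednK.
by rewrite mem_sorted_support inE.
Qed.

Hypothesis lab : labelling.

Lemma rho_asym e e' : rho e e' -> ~~ rho e' e.
Proof. by move=> /lab[_ h]; apply/negP => /lab[_]; lia. Qed.

Lemma chain_listing w : admissible w -> chain_of (listing (S := support_of w)).
Proof.
move=> aw i j ij; have s0 := size_sorted_support aw.
have lt_size (p : 'I_(size (sorted_support (support_of w))).-1.+1) :
  (p < size (sorted_support (support_of w)))%N by have := ltn_ord p; lia.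
have neq : listing i != listing j.
  by rewrite /listing nth_uniq ?sort_uniq ?enum_uniq ?lt_size//; lia.
have [_ _ /(_ _ _ (listing_support i aw) (listing_support j aw) neq)] := aw.
case/orP => // /lab[_].
have tr : transitive (relpre col leq) by move=> a b c; exact: leq_trans.
have := sort_sorted (leT := relpre col leq) (fun a b => leq_total _ _)
  (enum (support_of w)).
move=> /(sorted_ltn_nth tr e0) /(_ i j) /=.
rewrite !inE !lt_size => /(_ isT isT ij).
by rewrite /listing /sorted_support; lia.
Qed.

Lemma chain_inj n (c : 'I_n.+1 -> E) : chain_of c -> injective c.
Proof.
move=> hc i j; apply: contra_eq; rewrite neq_ltn => /orP[] /hc h.
  by apply/eqP => ij; move: (h) (rho_asym h); rewrite ij => ->.
by apply/eqP => ij; move: (h) (rho_asym h); rewrite ij => ->.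
Qed.

Lemma chain_last n (c : 'I_n.+1 -> E) : chain_of c ->
  weakly_increasing (last \o c).
Proof.
move=> hc i j; rewrite leq_eqVlt => /orP[/eqP/val_inj -> //|/hc/lab[]//].
Qed.

Lemma chain_col n (c : 'I_n.+1 -> E) : chain_of c ->
  {homo col \o c : i j / (i < j)%N}.
Proof. by move=> hc i j /hc/lab[]. Qed.

Variable X : simplicial_space.
Let XS := ss_prod (underlying X) incr.

(** The point of the realization of X times [incr] with weights w on the simplex
    that x and the chain c determine. *)
Definition chain_point n (c : 'I_n.+1 -> E) (x : X k) (w : E -> R) :
    fat_realization R XS :=
  fat_proj (@fat_point R XS n
    (smap (last \o c) x, colours (col \o c)) (retr (w \o c))).

(** The [chain_point] of the chain formed by the support of w. *)
Definition weighted_point (x : X k) (w : E -> R) : fat_realization R XS :=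
  chain_point (listing (S := support_of w)) x w.

Lemma bary_chain n (c : 'I_n.+1 -> E) w : admissible w -> chain_of c ->
  covers c w -> bary (retr (w \o c)) = w \o c.
Proof.
move=> [w0 w1 _] hc cov; apply/funext => i; rewrite retrE// => [j|].
  exact: w0.
by rewrite -[RHS]w1 [RHS](sum_codom (chain_inj hc)).
Qed.

(** Nodes of weight zero may be dropped from a chain. *)
Lemma chain_point_restrict m n (c : 'I_n.+1 -> E) (c' : 'I_m.+1 -> E) x w :
  admissible w -> chain_of c -> chain_of c' -> covers c w ->
  (forall i, w (c' i) != 0) -> covers c' w ->
  chain_point c x w = chain_point c' x w.
Proof.
move=> aw hc hc' cov nz' cov'.
pose b i := sval (cid (cov _ (nz' i))).
have bK i : c' i = c (b i) by rewrite /b; case: cid.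
have hb : strictly_increasing b.
  move=> i j ij; rewrite ltnNge; apply/negP; rewrite leq_eqVlt => /orP[/eqP|].
    by move=> /val_inj bij; have := chain_inj hc' (etrans (bK i)
      (etrans (congr1 c (esym bij)) (esym (bK j)))) => ij'; move: ij;
      rewrite ij' ltnn.
  by move=> /hc; rewrite -!bK => /rho_asym; rewrite hc'.
rewrite /chain_point (fat_proj_restrict hb); last first.
  move=> j; rewrite bary_chain// => /cov'[i]; rewrite bK.
  by move=> /(chain_inj hc) ->; exists i.
have ec : c' = c \o b by apply/funext => i; rewrite /= bK.
rewrite bary_chain// -compA -ec; congr (fat_proj (fat_point _ _)).
congr pair; last first.
  apply: val_inj; apply/funext => i /=.
  have := val_colours (chain_col hc); have := val_colours (chain_col hc').
  by rewrite !set_valE /= => -> /= ->; rewrite bK.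
rewrite (smapE X (chain_last hc)) (smapE X (chain_last hc')).
move: (chain_last hc'); rewrite ec => h.
exact/esym/sp_map_comp.
Qed.

Lemma weighted_point_chain n (c : 'I_n.+1 -> E) x w :
  admissible w -> chain_of c -> covers c w ->
  weighted_point x w = chain_point c x w.
Proof.
move=> aw hc cov; apply/esym/chain_point_restrict => //.
- exact: chain_listing.
- by move=> i; exact: listing_support.
- by apply: covers_listing => e; rewrite inE.
Qed.

Lemma exact_chain w : admissible w -> exists n (c : 'I_n.+1 -> E),
  [/\ chain_of c, covers c w & forall i, w (c i) != 0].
Proof.
move=> aw; exists _, (listing (S := support_of w)); split.
- exact: chain_listing.
- by apply: covers_listing => e; rewrite inE.
- by move=> i; exact: listing_support.
Qed.

Lemma smap_continuous m n (a : 'I_m.+1 -> 'I_n.+1) :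
  continuous (smap (X := X) a).
Proof. exact: sp_map_continuous. Qed.

(** The parameter space is covered by the finitely many closed sets on which the
    support of the weights is contained in a given set S of nodes; whenever S is
    a chain, the map is continuous there as a single [chain_point]. *)
Lemma weighted_point_continuous (Z : topologicalType) (x : Z -> X k)
    (w : Z -> E -> R) :
  continuous x -> (forall e, continuous (w^~ e)) ->
  (forall z, admissible (w z)) ->
  continuous (fun z => weighted_point (x z) (w z)).
Proof.
move=> cx cw aw.
have cc n (c : 'I_n.+1 -> E) : continuous (fun z => chain_point c (x z) (w z)).
  pose q z : fat_piece R XS n :=
    ((smap (last \o c) (x z), colours (col \o c)), retr (w z \o c)).
  have cq : continuous q.
    apply: (@continuous_pair _ (XS n) (simplex R n) (fun z =>
      (smap (last \o c) (x z), colours (col \o c)) : XS n)); last first.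
      by apply: retr_continuous => i; exact: cw.
    apply: (@continuous_pair _ (X n) (incr n) (fun z => smap (last \o c) (x z))
      (fun=> colours (col \o c))); last exact: cst_continuous.
    by move=> z; apply: continuous_comp; [exact: cx|exact: smap_continuous].
  move=> z; apply: (@continuous_comp _ (fat_sum R XS) _
    (existT (fat_piece R XS) n \o q)); last exact: fat_proj_continuous.
  by apply: continuous_comp; [exact: cq|exact: existT_continuous].
apply/continuous_closedP => A cA.
(* The preimage of A is the union of the closed sets [D S]. *)
pose D (S : {set E}) : set Z := if `[< chain_of (listing (S := S)) >] then
  (\bigcap_(e in [set e | e \notin S]) [set z | w z e = 0]) `&`
  (fun z => chain_point (listing (S := S)) (x z) (w z)) @^-1` A else set0.
rewrite (_ : _ @^-1` _ = \bigcup_(S in [set: {set E}]) D S); last first.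
  apply/seteqP; split=> [z Az|z [S _]]; rewrite /D /=.
    exists (support_of (w z)) => //; rewrite asboolT; last exact: chain_listing.
    by split=> // e /=; rewrite inE => /negPn/eqP.
  case: asboolP => // hS [zS]; rewrite /= -weighted_point_chain//.
  apply: covers_listing => e we; apply/negPn/negP => /zS /= /eqP.
  exact/negP.
apply: closed_bigcup => [|S _]; first exact: finite_finset.
rewrite /D; case: asboolP => _.

  apply: closedI; last first.
    by move/continuous_closedP: (@cc _ (listing (S := S))); apply.
  apply: closed_bigI => e _.
  move/continuous_closedP: (cw e) => /(_ [set 0]); apply.
  exact: closed_eq.
exact: closed0.
Qed.

End chains.

(** Two systems of nodes compared along a map iota of nodes lying over a map of
    vertices a; this yields compatibility with faces (iota induced by a coface
    map) and independence of the colours (iota the identity). *)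
Section pullback.
Variables (R : realType) (X : simplicial_space).
Variables (E E' : finType) (e0 : E) (e0' : E') (rho : rel E) (rho' : rel E').
Variables (k k' : nat) (last : E -> 'I_k.+1) (last' : E' -> 'I_k'.+1).
Variables (col : E -> nat) (col' : E' -> nat).
Hypotheses (lab : labelling rho last col) (lab' : labelling rho' last' col').
Variables (a : 'I_k.+1 -> 'I_k'.+1) (ha : weakly_increasing a).
Variables (iota : E -> E') (w : E -> R) (w' : E' -> R) (x' : X k').
Hypotheses (aw : admissible rho w) (aw' : admissible rho' w').
Hypothesis iota_rho : forall e1 e2, rho e1 e2 -> rho' (iota e1) (iota e2).
Hypothesis w'E : forall e, w' (iota e) = w e.
Hypothesis w'_cov : forall e', w' e' != 0 -> exists e, e' = iota e.
Hypothesis last'E : forall e, w e != 0 -> last' (iota e) = a (last e).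

Lemma exact_chain_pullback : exists n (c : 'I_n.+1 -> E),
  [/\ chain_of rho c, covers c w, chain_of rho' (iota \o c),
      covers (iota \o c) w' & forall i, w (c i) != 0].
Proof.
have [n [c [hc cov nz]]] := exact_chain e0 lab aw.
exists n, c; split => //.
- by move=> i j ij; exact/iota_rho/hc.
- move=> e' /[dup] /w'_cov[e ->]; rewrite w'E => /cov[i ->].
  by exists i.
Qed.

Lemma smap_pullback n (c : 'I_n.+1 -> E) :
  chain_of rho c -> chain_of rho' (iota \o c) -> (forall i, w (c i) != 0) ->
  smap (last' \o (iota \o c)) x' = smap (last \o c) (sp_map ha x').
Proof.
move=> hc hc' nz.
have e : last' \o (iota \o c) = a \o (last \o c).
  by apply/funext => i /=; rewrite last'E.
rewrite (smapE X (chain_last lab hc)) (smapE X (chain_last lab' hc')).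
move: (chain_last lab' hc'); rewrite e => h.
exact: sp_map_comp.
Qed.

Lemma weighted_point_pullback : (forall e, w e != 0 -> col' (iota e) = col e) ->
  weighted_point e0' last' col' x' w' =
    weighted_point e0 last col (sp_map ha x') w.
Proof.
move=> colE; have [n [c [hc cov hc' cov' nz]]] := exact_chain_pullback.
rewrite (weighted_point_chain e0' lab' _ aw' hc' cov').
rewrite (weighted_point_chain e0 lab _ aw hc cov).
rewrite /chain_point smap_pullback//.
have -> : col' \o (iota \o c) = col \o c by apply/funext => i /=; rewrite colE.
by have -> : w' \o (iota \o c) = w \o c by apply/funext => i /=; rewrite w'E.
Qed.

(** After projection to the realization of X the colours are irrelevant. *)
Lemma fat_map_weighted_point_pullback :
  fat_map (ss_fst (underlying X) incr) (weighted_point e0' last' col' x' w') =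
  fat_map (ss_fst (underlying X) incr)
    (weighted_point e0 last col (sp_map ha x') w).
Proof.
have [n [c [hc cov hc' cov' nz]]] := exact_chain_pullback.
rewrite (weighted_point_chain e0' lab' _ aw' hc' cov').
rewrite (weighted_point_chain e0 lab _ aw hc cov).
rewrite !fat_map_proj /fat_sum_map /= smap_pullback//.
by have -> : w' \o (iota \o c) = w \o c by apply/funext => i /=; rewrite w'E.
Qed.

End pullback.

(** * Weights for barycentric subdivision *)

Section gap.
Variables (R : realType) (I : finType).
Implicit Types (F : {set I}) (p : I -> R).

(** For nonempty F, the length (cut off at 1) of the interval of heights h > 0
    with F equal to the superlevel set of p at h, namely the interval between
    the maximum of 0 and the values of p outside F, and the minimum of p on F.
    The sets F with positive gap form a chain: the flag of superlevel sets,
    which is the simplex of the barycentric subdivision containing p. *)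
Definition gap F p : R := if F == finset.set0 then 0 else
  Num.max 0 (\big[Num.min/1]_(a in F)
    Num.min (p a) (\big[Num.min/1]_(b | b \notin F) (p a - p b))).

Lemma gap_ge0 F p : 0 <= gap F p.
Proof. by rewrite /gap; case: ifP => // _; rewrite le_max lexx. Qed.

Lemma gap_gt0P F p : 0 < gap F p <->
  F != finset.set0 /\
  forall a, a \in F -> 0 < p a /\ forall b, b \notin F -> p b < p a.
Proof.
rewrite /gap; case: ifPn => [_|F0]; first by rewrite ltxx; split=> // -[].
rewrite lt_max ltxx /=; split=> [/bigmin_gtP[_ h]|[_ h]].
  split=> // a /h; rewrite lt_min => /andP[-> /bigmin_gtP[_ h']]; split=> // b.
  by move=> /h'; rewrite subr_gt0.
apply: lt_bigmin => // a /h[pa pb]; rewrite lt_min pa /=.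
by apply: lt_bigmin => // b /pb; rewrite subr_gt0.
Qed.

Lemma gap_neq0P F p : gap F p != 0 <->
  F != finset.set0 /\
  forall a, a \in F -> 0 < p a /\ forall b, b \notin F -> p b < p a.
Proof. by rewrite -gap_gt0P lt0r gap_ge0 andbT. Qed.

Lemma gap_eq0 F p : (forall a, p a <= 0) -> gap F p = 0.
Proof.
move=> p0; apply/eqP/negPn/negP => /gap_neq0P[/finset.set0Pn[a aF] /(_ a aF)[]].
by rewrite ltNge p0.
Qed.

Lemma gap_chain F F' p : gap F p != 0 -> gap F' p != 0 -> F != F' ->
  (F \proper F') || (F' \proper F).
Proof.
move=> /gap_neq0P[_ h] /gap_neq0P[_ h'] FF'; rewrite !properE.
have [FsF'|/subsetPn[a aF aF']] := boolP (F \subset F').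
  by apply/orP; left; apply: contra FF'; rewrite finset.eqEsubset FsF'.
apply/orP; right; rewrite andbT; apply/fintype.subsetP => b bF'.
apply/negPn/negP => bF.
have [_ /(_ _ bF) ab] := h _ aF; have [_ /(_ _ aF') ba] := h' _ bF'.
by have := lt_trans ab ba; rewrite ltxx.
Qed.

Lemma gap_exists p v : 0 < p v -> exists F, gap F p != 0.
Proof.
move=> pv; have [u _ hu] : exists2 u, true & forall b, p b <= p u.
  by case: (@arg_maxP _ _ _ v xpredT p) => // u _ hu; exists u => // b; exact: hu.
exists [set b | p b == p u]%SET; apply/gap_neq0P; split.
  by apply/finset.set0Pn; exists u; rewrite inE.
move=> a; rewrite inE => /eqP ->; split; first exact: lt_le_trans (hu v).
by move=> b; rewrite inE lt_neqAle => -> /=; exact: hu.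
Qed.

Lemma gap_continuous (Z : topologicalType) F (p : Z -> I -> R) :
  (forall a, continuous (p^~ a)) -> continuous (fun z => gap F (p z)).
Proof.
move=> cp; rewrite /gap; case: eqP => _; first exact: cst_continuous.
apply: continuous_maxr; first exact: cst_continuous.
apply: continuous_bigminr => a; apply: continuous_minr => //.
by apply: continuous_bigminr => b; exact: continuous_subr.
Qed.

End gap.

(** Extending p by zero to a larger vertex set does not change the gaps. *)
Lemma gap_imset (R : realType) (I J : finType) (h : I -> J) (F : {set I})
    (p : I -> R) (q : J -> R) : injective h ->
  (forall i, q (h i) = p i) -> (forall j, (forall i, j != h i) -> q j = 0) ->
  gap (h @: F) q = gap F p.
Proof.
move=> inj_h qE q0; rewrite /gap imset_eq0; case: eqP => // _; congr (Num.max 0 _).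
have ext (m n : R) : (forall y, (y <= m) = (y <= n)) -> m = n.
  by move=> mn; apply/eqP; rewrite eq_le -mn lexx /= mn lexx.
apply: ext => y; apply/bigmin_geP/bigmin_geP => -[y1 hy]; split=> //.
  move=> a aF; have := hy (h a) (imset_f h aF); rewrite !le_min qE.
  move=> /andP[-> /bigmin_geP[_ hb]] /=; apply/bigmin_geP; split=> // b bF.
  by rewrite -(qE b); apply: hb; rewrite mem_imset.
move=> _ /imsetP[a aF ->]; have := hy a aF; rewrite !le_min qE.
move=> /andP[ya /bigmin_geP[_ hb]]; rewrite ya /=; apply/bigmin_geP; split=> // j jF.
have [[i ji]|nj] := pselect (exists i, j = h i).
  by subst j; rewrite qE; apply: hb; move: jF; rewrite mem_imset.
by rewrite q0 ?subr0// => i; apply/eqP => ji; apply: nj; exists i.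
Qed.

(** * The nodes of the subdivided prism *)

Section nodes.
Variable k : nat.

(** Vertices v of the standard k-simplex, and two copies [(F, false)] and
    [(F, true)] of each set F of vertices, standing for its barycentre. *)
Definition node : finType := ('I_k.+1 + {set 'I_k.+1} * bool)%type.

(** Vertices are in their usual order, and v precedes [(F, true)] for v in F.
    Within each copy, nonempty sets are ordered by strict inclusion; a nonempty F
    in the copy [false] precedes every F' containing it in the copy [true].
    Vertices and nodes [(F, false)] are not related. *)
Definition node_rel : rel node := fun e e' =>
  match e, e' with
  | inl v, inl v' => (v < v')%N
  | inl v, inr (F, b) => b && (v \in F)
  | inr _, inl _ => false
  | inr (F, b), inr (F', b') => (F != finset.set0) &&
      (if b == b' then F \proper F' else ~~ b && (F \subset F'))
  end.

(** The largest element of F, and 0 for F empty. *)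
Definition top_vertex (F : {set 'I_k.+1}) : 'I_k.+1 := inord (\max_(v in F) v).

Definition last_vertex (e : node) : 'I_k.+1 :=
  match e with inl v => v | inr (F, _) => top_vertex F end.

(** The colours of the nodes of a simplex with vertex colours f. The colour of
    [(F, true)] exceeds those of the vertices in F and that of [(F, false)]; the
    colour of [(F, false)] does not involve f. *)
Definition node_colour (f : 'I_k.+1 -> nat) (e : node) : nat :=
  match e with
  | inl v => f v
  | inr (F, false) => #|F|
  | inr (F, true) => (f (top_vertex F) + #|F|).+1
  end.

Lemma val_top_vertex F : top_vertex F = (\max_(v in F) v)%N :> nat.
Proof. by rewrite inordK// ltnS; apply/bigmax_leqP => v _; rewrite -ltnS. Qed.

Lemma top_vertex_ge (F : {set 'I_k.+1}) v : v \in F -> (v <= top_vertex F)%N.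
Proof. 
by move=> vF; rewrite val_top_vertex; exact: leq_bigmax_cond. Qed.

Lemma top_vertex_in F : F != finset.set0 -> top_vertex F \in F.
Proof.
move=> /finset.set0Pn[v vF]; have F0 : (0 < #|F|)%N by apply/card_gt0P; exists v.
have [u uF hu] := eq_bigmax_cond (fun v : 'I_k.+1 => nat_of_ord v) F0.
by rewrite (_ : top_vertex F = u)//; apply: val_inj; rewrite /= val_top_vertex hu.
Qed.

Lemma top_vertexS (F F' : {set 'I_k.+1}) : F != finset.set0 -> F \subset F' ->
  (top_vertex F <= top_vertex F')%N.
Proof.
move=> F0 FF'; apply: top_vertex_ge; apply: (fintype.subsetP FF').
exact: top_vertex_in.
Qed.

Lemma node_labelling (f : 'I_k.+1 -> nat) : {homo f : i j / (i < j)%N} ->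
  labelling node_rel last_vertex (node_colour f).
Proof.
move=> hf; have hf' : {homo f : i j / (i <= j)%N}.
  by move=> i j; rewrite (leq_eqVlt i) => /orP[/eqP/val_inj -> //|/hf/ltnW].
move=> [v|[F b]] [v'|[F' b']]//=.
- by move=> vv'; split; [exact: ltnW|exact: hf].
- case: b' => //= /top_vertex_ge vF; split=> //.
  by rewrite ltnS (leq_trans (hf' _ _ vF))// leq_addr.
- case/andP => F0; case: b b' => -[] //= FF'.
  + have FS := proper_sub FF'; have t := top_vertexS F0 FS; split=> //.
    by rewrite ltnS -addnS leq_add ?hf' ?proper_card.
  + split; first exact: top_vertexS.
    by rewrite ltnS (leq_trans (subset_leq_card FF'))// leq_addl.
  + by have FS := proper_sub FF'; split; [exact: top_vertexS|exact: proper_card].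
Qed.

End nodes.

(** * The weights of the nodes in the course of the homotopy *)

Section weights.
Variable R : realType.

(** Two heights [lam s] and [mu s] that depend on the time s: the pair starts at
    (1, 0) for s = 0, mu rises until s = 1/2, and then lam sinks until the pair is
    (0, 1) for s = 1. *)
Definition lam (s : R) : R := Num.min 1 (Num.max 0 (2 - 2 * s)).
Definition mu (s : R) : R := Num.min 1 (Num.max 0 (2 * s)).

Lemma lam_ge0 s : 0 <= lam s. Proof. by rewrite /lam le_min ler01 le_max lexx. Qed.
Lemma mu_ge0 s : 0 <= mu s. Proof. by rewrite /mu le_min ler01 le_max lexx. Qed.
Lemma lam1_or_mu1 s : lam s = 1 \/ mu s = 1.
Proof.
rewrite /lam /mu; have [s2|s2] := leP s (1 / 2); [left|right].
  by rewrite min_l// le_max; apply/orP; right; lra.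
by rewrite min_l// le_max; apply/orP; right; lra.
Qed.

Variable k : nat.
Implicit Types (t : 'I_k.+1 -> R) (s : R).

(** The part of t between the heights mu and lam; it is zero if lam <= mu. *)
Definition middle t s (v : 'I_k.+1) : R := Num.max 0 (Num.min (t v) (lam s) - mu s).
(** The part of t below the heights mu and lam. *)
Definition bottom t s (v : 'I_k.+1) : R := Num.min (Num.min (t v) (lam s)) (mu s).

(** The vertices carry the part of t above lam, the nodes [(F, false)] the part
    between mu and lam, and the nodes [(F, true)] the part below both. *)
Definition raw_weight t s (e : node k) : R :=
  match e with
  | inl v => Num.max 0 (t v - lam s)
  | inr (F, false) => gap F (middle t s)
  | inr (F, true) => gap F (bottom t s)
  end.

Definition weight t s e : R := raw_weight t s e / \sum_e raw_weight t s e.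

Lemma raw_weight_ge0 t s e : 0 <= raw_weight t s e.
Proof. by case: e => [v|[F []]] /=; rewrite ?gap_ge0// le_max lexx. Qed.

Lemma max0_neq0 (x : R) : (Num.max 0 x != 0) = (0 < x).
Proof. by rewrite neq_lt lt_max ltxx gt_max ltxx. Qed.

(** A larger set of vertices belongs to a smaller height; and one of lam and mu
    is 1, so that a vertex and a node [(F, false)] never have positive weight
    together. *)
Lemma raw_weight_chain t s e e' : (forall v, t v <= 1) ->
  raw_weight t s e != 0 -> raw_weight t s e' != 0 -> e != e' ->
  node_rel e e' || node_rel e' e.
Proof.
move=> t1.
have vd v F : raw_weight t s (inl v) != 0 -> gap F (middle t s) = 0.
  rewrite /= max0_neq0 subr_gt0 => tv; apply: gap_eq0 => u.
  rewrite /middle ge_max lexx /= subr_le0.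
  have [l1|->] := lam1_or_mu1 s; first by have := t1 v; rewrite leNgt -l1 tv.
  by rewrite ge_min t1.
have vc v F : raw_weight t s (inl v) != 0 -> gap F (bottom t s) != 0 -> v \in F.
  rewrite /= max0_neq0 subr_gt0 => tv /gap_neq0P[/finset.set0Pn[a aF] h].
  apply/negPn/negP => vF; have [_ /(_ _ vF)] := h a aF.
  rewrite /bottom [Num.min (t v) _]min_r ?(ltW tv)// ltNge; case/negP.
  by move: (lam s) (mu s) => l m; rewrite le_min !ge_min !lexx ?orbT.
have dc F F' : gap F (middle t s) != 0 -> gap F' (bottom t s) != 0 -> F \subset F'.
  move=> /gap_neq0P[_ h] /gap_neq0P[/finset.set0Pn[b bF'] h'].
  apply/fintype.subsetP => a aF; apply/negPn/negP => aF'.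
  have [+ _] := h a aF; rewrite /middle lt_max ltxx /= subr_gt0 => ma.
  have [_ /(_ _ aF')] := h' b bF'.
  by rewrite /bottom [X in X < _]min_r ?(ltW ma)// lt_min ltxx andbF.
have ne (F : {set 'I_k.+1}) (p : 'I_k.+1 -> R) : gap F p != 0 ->
  F != finset.set0 by move=> /gap_neq0P[].
move: e e' => [v|[F b]] [v'|[F' b']].
- by move=> _ _ vv' /=; rewrite -neq_ltn; apply: contra vv' => /eqP/val_inj ->.
- by case: b' => hv hF _ /=; [rewrite (vc v)|move: hF; rewrite /= (vd v)// eqxx].
- by case: b => hF hv _ /=; [rewrite (vc v')|move: hF; rewrite /= (vd v')// eqxx].
- case: b b' => -[] /= hF hF' FF'; rewrite ?(ne _ _ hF) ?(ne _ _ hF') /=.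
  + by apply: gap_chain hF hF' _; apply: contra FF' => /eqP ->.
  + by rewrite (dc F').
  + by rewrite (dc F).
  + by apply: gap_chain hF hF' _; apply: contra FF' => /eqP ->.
Qed.

Lemma raw_weight_gt0 t s v : 0 < t v -> exists e, raw_weight t s e != 0.
Proof.
move=> tv; have [tl|tl] := ltP (lam s) (t v).
  by exists (inl v); rewrite /= max0_neq0 subr_gt0.
have [tm|tm] := ltP (mu s) (t v).
  have /gap_exists[F hF] : 0 < middle t s v.
    by rewrite /middle min_l// lt_max subr_gt0 tm orbT.
  by exists (inr (F, false)).
have /gap_exists[F hF] : 0 < bottom t s v by rewrite /bottom min_l ?min_l.
by exists (inr (F, true)).
Qed.

Lemma sum_raw_weight_gt0 t s : (forall v, 0 <= t v) -> \sum_v t v = 1 ->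
  0 < \sum_e raw_weight t s e.
Proof.
move=> t0 t1.
have [v tv] : exists v, 0 < t v.
  apply: contrapT => /forallNP h; have /eqP := t1.
  rewrite big1 ?(eq_sym 0) ?oner_eq0//.
  by move=> v _; apply/eqP; rewrite eq_le t0 andbT leNgt; apply/negP; exact: h.
have [e he] := raw_weight_gt0 s tv.
rewrite (bigD1 e)//= ltr_pwDl//; first by rewrite lt0r he raw_weight_ge0.
by apply: sumr_ge0 => e' _; exact: raw_weight_ge0.
Qed.

Lemma weight_admissible (t : simplex R k) s :
  admissible (@node_rel k) (weight (bary t) s).
Proof.
have S0 := sum_raw_weight_gt0 s (simplex_ge0 t) (simplex_sum t).
split=> [e||e e'].
- by rewrite divr_ge0 ?raw_weight_ge0// ltW.
- by rewrite -mulr_suml divff// lt0r_neq0.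
- rewrite /weight !mulf_eq0 !negb_or => /andP[he _] /andP[he' _].
  by apply: raw_weight_chain he he'; exact: simplex_le1.
Qed.

Lemma weight_continuous e :
  continuous (fun p : simplex R k * R => weight (bary p.1) p.2 e).
Proof.
have cs : continuous (fun p : simplex R k * R => p.2) by move=> p; exact: cvg_snd.
have ct v : continuous (fun p : simplex R k * R => bary p.1 v).
  move=> p; apply: (@continuous_comp _ _ _ fst (fun t : simplex R k => bary t v)).
    exact: cvg_fst.
  exact: simplex_coord_continuous.
have cl : continuous (fun p : simplex R k * R => lam p.2).
  apply: continuous_minr; first exact: cst_continuous.
  apply: continuous_maxr; first exact: cst_continuous.
  apply: continuous_subr; first exact: cst_continuous.
  by apply: continuous_mulr => //; exact: cst_continuous.
have cm : continuous (fun p : simplex R k * R => mu p.2).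
  apply: continuous_minr; first exact: cst_continuous.
  apply: continuous_maxr; first exact: cst_continuous.
  by apply: continuous_mulr => //; exact: cst_continuous.
have cr e' : continuous (fun p : simplex R k * R => raw_weight (bary p.1) p.2 e').
  case: e' => [v|[F []]] /=.
  - apply: continuous_maxr; first exact: cst_continuous.
    exact: continuous_subr.
  - apply: gap_continuous => v; apply: continuous_minr => //.
    exact: continuous_minr.
  - apply: gap_continuous => v; apply: continuous_maxr.
      exact: cst_continuous.
    by apply: continuous_subr => //; exact: continuous_minr.
apply: continuous_divr => // [p|]; last exact: continuous_sumr.
apply: lt0r_neq0.
by apply: sum_raw_weight_gt0; [exact: simplex_ge0|exact: simplex_sum].
Qed.

Lemma raw_weight1 t e : (forall v, 0 <= t v <= 1) ->
  raw_weight t 1 e = if e is inl v then t v else 0.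
Proof.
move=> t01.
have l0 : lam 1 = 0 by rewrite /lam mulr1 subrr maxxx min_r.
have m1 : mu 1 = 1 by rewrite /mu mulr1 max_r// min_l// ler1n.
case: e => [v|[F []]] /=.
- by rewrite l0 subr0 max_r//; have /andP[] := t01 v.
- apply: gap_eq0 => v; rewrite /bottom l0 m1 [Num.min (t v) 0]min_r ?min_l//.
  by have /andP[] := t01 v.
- apply: gap_eq0 => v; rewrite /middle l0 m1 [Num.min (t v) 0]min_r.
    by rewrite sub0r ge_max lexx lerN10.
  by have /andP[] := t01 v.
Qed.

Lemma weight1 (t : simplex R k) e :
  weight (bary t) 1 e = if e is inl v then bary t v else 0.
Proof.
have t01 v : 0 <= bary t v <= 1 by rewrite simplex_ge0 simplex_le1.
rewrite /weight raw_weight1//; under eq_bigr do rewrite raw_weight1//.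
rewrite (@sum_codom _ 'I_k.+1 (node k) inl); last 2 first.
- by move=> u v [].
- by case=> [v _|p]; [exists v|rewrite eqxx].
by rewrite simplex_sum divr1.
Qed.

Lemma weight0_neq0 (t : simplex R k) e : weight (bary t) 0 e != 0 ->
  exists F, e = inr (F, false) .
Proof.
have l1 : lam 0 = 1 by rewrite /lam mulr0 subr0 max_r// min_l// ler1n.
have m0 : mu 0 = 0 by rewrite /mu mulr0 maxxx min_r.
rewrite /weight mulf_eq0 negb_or => /andP[+ _].
case: e => [v|[F []]] /=; last by exists F.
- by rewrite l1 max0_neq0 subr_gt0 ltNge simplex_le1.
- by rewrite gap_eq0 ?eqxx// => v; rewrite /bottom m0 ge_min lexx orbT.
Qed.

End weights.

(** * Compatibility with faces *)

Section node_lift.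
Variables (R : realType) (k : nat) (i : 'I_k.+2).

(** The map of nodes induced by the coface map omitting i. *)
Definition node_lift (e : node k) : node k.+1 :=
  match e with inl v => inl (lift i v) | inr (F, b) => inr (lift i @: F, b) end.

Lemma node_lift_inj : injective node_lift.
Proof.
move=> [v|[F b]] [v'|[F' b']] //= h.
  by congr inl; apply: (@lift_inj _ i); apply: val_inj; case: h.
by case: h => /(imset_inj (@lift_inj _ i)) -> ->.
Qed.

Lemma node_lift_rel e e' : node_rel e e' -> node_rel (node_lift e) (node_lift e').
Proof.
case: e e' => [v|[F b]] [v'|[F' b']] //=.
- exact: lift_strictly_increasing.
- by case/andP => -> vF; rewrite imset_f.
- rewrite imset_eq0 => /andP[-> /=].
  case: eqP => _; first by apply: imset_proper => p q _ _; exact: lift_inj.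
  by case/andP => -> /=; exact: imsetS.
Qed.

End node_lift.

Section face_weights.
Variables (R : realType) (k : nat) (i : 'I_k.+2) (t : simplex R k) (s : R).
Let t' := coface i t.

Lemma bary_coface_lift v : bary t' (lift i v) = bary t v.
Proof. by rewrite bary_coface liftK. Qed.

Lemma bary_coface_omitted : bary t' i = 0.
Proof. by rewrite bary_coface unlift_none. Qed.

Lemma middle_coface_omitted : middle (bary t') s i = 0.
Proof.
rewrite /middle bary_coface_omitted min_l ?lam_ge0// max_l//.
by rewrite sub0r oppr_le0 mu_ge0.
Qed.

Lemma bottom_coface_omitted : bottom (bary t') s i = 0.
Proof. by rewrite /bottom bary_coface_omitted min_l min_l ?lam_ge0 ?mu_ge0. Qed.

Lemma not_lift (j : 'I_k.+2) : (forall v : 'I_k.+1, j != lift i v) -> j = i.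
Proof.
by move=> h; case: (unliftP i j) => // v jv; have := h v; rewrite -jv eqxx.
Qed.

Lemma raw_weight_coface e :
  raw_weight (bary t') s (node_lift i e) = raw_weight (bary t) s e.
Proof.
case: e => [v|[F []]] /=; first by rewrite bary_coface_lift.
- apply: gap_imset; first exact: lift_inj.
    by move=> v; rewrite /bottom bary_coface_lift.
  by move=> j /not_lift ->; exact: bottom_coface_omitted.
- apply: gap_imset; first exact: lift_inj.
    by move=> v; rewrite /middle bary_coface_lift.
  by move=> j /not_lift ->; exact: middle_coface_omitted.
Qed.

Lemma raw_weight_coface_neq0 e' : raw_weight (bary t') s e' != 0 ->
  exists e, e' = node_lift i e.
Proof.
have gapF (F : {set 'I_k.+2}) (p : 'I_k.+2 -> R) : p i = 0 -> gap F p != 0 ->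
      exists F' : {set 'I_k.+1}, F = lift i @: F'.
  move=> pi /gap_neq0P[_ h]; exists (lift i @^-1: F); apply/setP => j.
  apply/idP/imsetP => [jF|[v + ->]]; last by rewrite inE.
  case: (unliftP i j) => [v jv|ji]; first by exists v; rewrite // inE -jv.
  by have [] := h j jF; rewrite ji pi ltxx.
case: e' => [v|[F []]] /=.
- case: (unliftP i v) => [u ->|->]; first by exists (inl u).
  by rewrite bary_coface_omitted sub0r max_l ?eqxx// oppr_le0 lam_ge0.
- by move=> /(gapF _ _ bottom_coface_omitted)[F' ->]; exists (inr (F', true)).
- by move=> /(gapF _ _ middle_coface_omitted)[F' ->]; exists (inr (F', false)).
Qed.

Lemma weight_coface e :
  weight (bary t') s (node_lift i e) = weight (bary t) s e.
Proof.
rewrite /weight raw_weight_coface.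
rewrite (sum_codom (@node_lift_inj _ i)); last exact: raw_weight_coface_neq0.
by under eq_bigr do rewrite raw_weight_coface.
Qed.

Lemma weight_coface_neq0 e' : weight (bary t') s e' != 0 ->
  exists e, e' = node_lift i e.
Proof.
by rewrite mulf_eq0 negb_or => /andP[/raw_weight_coface_neq0].
Qed.

End face_weights.

Lemma weight_set_neq0 (R : realType) k (t : 'I_k.+1 -> R) s F b :
  weight t s (inr (F, b)) != 0 -> F != finset.set0.
Proof.
rewrite mulf_eq0 negb_or => /andP[+ _].
by case: b => /= /gap_neq0P[].
Qed.

Lemma top_vertex_lift k (i : 'I_k.+2) (F : {set 'I_k.+1}) : F != finset.set0 ->
  top_vertex (lift i @: F) = lift i (top_vertex F).
Proof.
move=> F0; apply/val_inj/eqP; rewrite eqn_leq; apply/andP; split; last first.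
  by apply: top_vertex_ge; apply: imset_f; exact: top_vertex_in.
have /imsetP[v vF ->] : top_vertex (lift i @: F) \in lift i @: F.
  by apply: top_vertex_in; rewrite imset_eq0.
apply: (strictly_weakly (@lift_strictly_increasing k i)).
exact: top_vertex_ge.
Qed.

Lemma last_vertex_lift (R : realType) k (i : 'I_k.+2) (t : 'I_k.+1 -> R) s e :
  weight t s e != 0 ->
  last_vertex (node_lift i e) = lift i (last_vertex e).
Proof.
by case: e => [//|[F b]] /weight_set_neq0 F0 /=; rewrite top_vertex_lift.
Qed.

Lemma node_colour_lift (R : realType) k (i : 'I_k.+2) (t : 'I_k.+1 -> R) s e f :
  weight t s e != 0 ->
  node_colour f (node_lift i e) = node_colour (f \o lift i) e.
Proof.
case: e => [//|[F b]] /weight_set_neq0 F0 /=.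
by rewrite top_vertex_lift// card_imset//; exact: lift_inj.
Qed.

(** * Maps out of the realization *)

Section realization_homotopy.
Variables (R : realType) (Y : semi_simplicial_space) (W : topologicalType).

(** Maps out of the product of a fat realization with the line may be defined
    before gluing, because the line is locally compact: by currying, such a map
    is a map to a space of functions with the compact-open topology, to which
    the universal property of the quotient applies. *)
Lemma fat_realization_homotopy (h : fat_sum R Y -> R -> W) :
  (forall k, continuous (fun p : fat_piece R Y k * R =>
     h (existT (fat_piece R Y) k p.1) p.2)) ->
  (forall p q, fat_glue p q -> h p = h q) ->
  exists H : fat_realization R Y * R -> W,
    continuous H /\ forall p s, H (fat_proj p, s) = h p s.
Proof.
move=> ch hE.
have hE' p q : fat_proj p = fat_proj q -> h p = h q.
  by move=> /fat_projP; elim=> [x y /hE|x|x y _ ->|x y z _ -> _ ->].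
pose H (q : fat_realization R Y) : R -> W := h (fat_repr q).
have HE p : H (fat_proj p) = h p by apply: hE'; exact: fat_reprK.
exists (uncurry H); split; last by move=> p s; rewrite /= HE.
have cH : continuous (H : fat_realization R Y -> {compact-open, R -> W}).
  apply/quotient_continuous.
  rewrite (_ : _ \o _ = h); last by apply/funext => p; exact: HE.
  move=> [k p] U nU; apply: (@existT_continuous _ (fat_piece R Y) k p).
  exact: (continuous_curry_fun (ch k) nU).
apply: continuous_uncurry => //.
- exact: locally_compactR.
- move=> q; rewrite -(fat_reprK q) HE; case: (fat_repr q) => k p.
  exact: (continuous_curry (ch k)).2.
Qed.

End realization_homotopy.

Lemma discrete_factor_continuous (A B C W : topologicalType)
    (D : topologicalType) (h : ((A * D) * B) * C -> W) :
  (forall d : D, open [set d]) ->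
  (forall d, continuous (fun p : (A * B) * C => h (((p.1.1, d), p.1.2), p.2))) ->
  continuous h.
Proof.
move=> dD ch p.
pose h0 (q : ((A * D) * B) * C) := h (((q.1.1.1, p.1.1.2), q.1.2), q.2).
have c1 : continuous (fun q : ((A * D) * B) * C => q.1).
  by move=> q; exact: cvg_fst.
have c11 : continuous (fun q : ((A * D) * B) * C => q.1.1).
  by move=> q; apply: (continuous_comp (c1 q)); exact: cvg_fst.
have cm : continuous (fun q : ((A * D) * B) * C => ((q.1.1.1, q.1.2), q.2)).
  apply: (@continuous_pair _ (A * B)%type C (fun q => (q.1.1.1, q.1.2))).
    apply: (@continuous_pair _ A B (fun q => q.1.1.1) (fun q => q.1.2)).
      by move=> r; apply: (continuous_comp (c11 r)); exact: cvg_fst.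
    by move=> r; apply: (continuous_comp (c1 r)); exact: cvg_snd.
  by move=> r; exact: cvg_snd.
have ch0 : continuous h0.
  by move=> q; exact: (continuous_comp (cm q) (ch _ _)).
have near_d : \forall q \near p, q.1.1.2 = p.1.1.2.
  have cd : continuous (fun q : ((A * D) * B) * C => q.1.1.2).
    by move=> r; apply: (continuous_comp (c11 r)); exact: cvg_snd.
  exact: (cd p [set p.1.1.2] (open_nbhs_nbhs (conj (dD _) erefl))).
have hp : h p = h0 p by rewrite /h0; case: (p) => [[[]]].
move=> U; rewrite hp => /(ch0 p); apply: filterS2 near_d => q qd.
by rewrite /= /h0 -qd; case: q {qd} => [[[]]].
Qed.

(** * The homotopy equivalence *)

Section unravelling.
Variables (R : realType) (X : simplicial_space).
Let Y := underlying X.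
Let XS := ss_prod Y incr.
Let fst_map : semi_simplicial_map XS Y := ss_fst Y incr.

(** The point of the homotopy at time s starting from the point t of a simplex x
    with vertex colours f; see [sd_point1] and [sd_point0] for the two ends. *)
Definition sd_point k (f : 'I_k.+1 -> nat) (x : X k) (t : simplex R k) (s : R) :
    fat_realization R XS :=
  weighted_point (inl ord0 : node k) (@last_vertex k) (node_colour f) x
    (weight (bary t) s).

Section one_simplex.
Variables (k : nat) (f f' : 'I_k.+1 -> nat).
Hypotheses (hf : {homo f : i j / (i < j)%N}) (hf' : {homo f' : i j / (i < j)%N}).
Variables (x : X k) (t : simplex R k).

Lemma fat_map_sd_point s :
  fat_map fst_map (sd_point f x t s) = fat_map fst_map (sd_point f' x t s).
Proof.
have hid : weakly_increasing (@id 'I_k.+1) by [].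
rewrite /sd_point -[in RHS](sp_map_id hid x).
apply: (@fat_map_weighted_point_pullback _ _ _ _ _ _ (@node_rel k) (@node_rel k) _ _
  _ _ _ _ _ _ id hid id) => //; try exact: node_labelling.
- exact: weight_admissible.
- exact: weight_admissible.
- by move=> e _; exists e.
Qed.

(** At time 0 only nodes [(F, false)] have positive weight, and their colours do
    not depend on f. *)
Lemma sd_point0 : sd_point f x t 0 = sd_point f' x t 0.
Proof.
have hid : weakly_increasing (@id 'I_k.+1) by [].
rewrite /sd_point -[in RHS](sp_map_id hid x).
apply: (@weighted_point_pullback _ _ _ _ _ _ (@node_rel k) (@node_rel k) _ _
  _ _ _ _ _ _ id hid id) => //; try exact: node_labelling.
- exact: weight_admissible.
- exact: weight_admissible.
- by move=> e _; exists e.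
- by move=> e /weight0_neq0[F ->].
Qed.

(** At time 1 the vertices have their barycentric coordinates as weights. *)
Lemma sd_point1 : sd_point f x t 1 = fat_proj (@fat_point R XS k (x, colours f) t).
Proof.
pose c : 'I_k.+1 -> node k := inl.
have hc : chain_of (@node_rel k) c by [].
have cov : covers c (weight (bary t) 1).
  by move=> e; rewrite weight1; case: e => [v _|p]; [exists v|rewrite eqxx].
have lab := node_labelling hf.
rewrite /sd_point (weighted_point_chain _ lab _ (weight_admissible t 1) hc cov).
rewrite /chain_point (smapE X (chain_last lab hc)) sp_map_id.
congr (fat_proj (fat_point _ _)).
by rewrite -[RHS]retr_simplex; congr retr; apply/funext => v; rewrite /= weight1.
Qed.

End one_simplex.

Section face.
Variables (k : nat) (i : 'I_k.+2) (f : 'I_k.+2 -> nat) (f' : 'I_k.+1 -> nat).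
Hypotheses (hf : {homo f : i j / (i < j)%N}) (hf' : {homo f' : i j / (i < j)%N}).
Variables (x : X k.+1) (t : simplex R k).

Lemma strict_comp_lift : {homo f \o lift i : p q / (p < q)%N}.
Proof. by move=> p q pq; apply/hf/lift_strictly_increasing. Qed.

Lemma sd_point_face s :
  sd_point f x (coface i t) s = sd_point (f \o lift i) (face (Y := Y) i x) t s.
Proof.
apply: (@weighted_point_pullback _ _ _ _ _ _ (@node_rel k) (@node_rel k.+1) _ _
  _ _ _ _ _ _ _ _ (node_lift i)).
- by apply: node_labelling; exact: strict_comp_lift.
- exact: node_labelling.
- exact: weight_admissible.
- exact: weight_admissible.
- exact: node_lift_rel.
- by move=> e; exact: weight_coface.
- by move=> e; exact: weight_coface_neq0.
- by move=> e; exact: last_vertex_lift.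
- by move=> e; exact: node_colour_lift.
Qed.

Lemma fat_map_sd_point_face s :
  fat_map fst_map (sd_point f x (coface i t) s) =
  fat_map fst_map (sd_point f' (face (Y := Y) i x) t s).
Proof.
by rewrite sd_point_face; apply: fat_map_sd_point => //; exact: strict_comp_lift.
Qed.

Lemma sd_point0_face :
  sd_point f x (coface i t) 0 = sd_point f' (face (Y := Y) i x) t 0.
Proof.
by rewrite sd_point_face; apply: sd_point0 => //; exact: strict_comp_lift.
Qed.

End face.

Lemma sd_point_continuous k (f : 'I_k.+1 -> nat) : {homo f : i j / (i < j)%N} ->
  continuous (fun p : fat_piece R Y k * R => sd_point f p.1.1 p.1.2 p.2).
Proof.
move=> hf.
have c1 : continuous (fun p : fat_piece R Y k * R => p.1).
  by move=> p; exact: cvg_fst.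
have cw : continuous (fun p : fat_piece R Y k * R => (p.1.2, p.2)).
  apply: (@continuous_pair _ (simplex R k) R (fun p => p.1.2) snd).
    by move=> p; apply: (continuous_comp (c1 p)); exact: cvg_snd.
  by move=> p; exact: cvg_snd.
apply: (@weighted_point_continuous R _ (inl ord0) _ _ _ _ (node_labelling hf) X _
  (fun p : fat_piece R Y k * R => p.1.1)
  (fun p => weight (bary p.1.2) p.2)) => [|e|p].
- by move=> p; apply: (continuous_comp (c1 p)); exact: cvg_fst.
- by move=> p; exact: (continuous_comp (cw p) (@weight_continuous _ _ e _)).
- exact: weight_admissible.
Qed.

Let id_colours k : {homo @nat_of_ord k : i j / (i < j)%N}.
Proof. by []. Qed.

(** The statement for an arbitrary simplicial space. *)
Theorem fat_map_fst_homotopy_equivalence :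
  homotopy_equivalence R (fat_map (R := R) fst_map).
Proof.
(* The homotopy inverse is G, which is constant in its second argument. It needs
   some colours of the vertices, here 0, ..., k; by [sd_point0] their choice does
   not matter. *)
have [G [cG GE]] : exists G : fat_realization R Y * R -> fat_realization R XS,
    continuous G /\ forall k (x : Y k) t s,
      G (fat_proj (fat_point x t), s) = sd_point (@nat_of_ord k.+1) x t 0.
  have [||G [cG GE]] := @fat_realization_homotopy R Y (fat_realization R XS)
    (fun p _ => sd_point (@nat_of_ord _) (projT2 p).1 (projT2 p).2 0).
  - move=> k.
    have c0 : continuous (fun p : fat_piece R Y k * R => (p.1, 0 : R)).
      apply: (@continuous_pair _ (fat_piece R Y k) R fst (fun=> 0)).
        by move=> p; exact: cvg_fst.
      exact: cst_continuous.
    move=> p.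
    exact: (continuous_comp (c0 p)
      (@sd_point_continuous k _ (@id_colours k.+1) (p.1, 0))).
  - move=> _ _ [k i y t]; apply/funext => _ /=; exact/esym/sd_point0_face.
  by exists G; split=> // k x t s; rewrite GE.
(* The homotopy on the realization of X times [incr]. *)
have [H [cH HE]] : exists H : fat_realization R XS * R -> fat_realization R XS,
    continuous H /\ forall k (x : Y k) (f : incr k) t s,
      H (fat_proj (@fat_point R XS k (x, f) t), s) = sd_point (set_val f) x t s.
  have [||H [cH HE]] := @fat_realization_homotopy R XS (fat_realization R XS)
    (fun p s => sd_point (set_val (projT2 p).1.2) (projT2 p).1.1 (projT2 p).2 s).
  - move=> k; apply: (@discrete_factor_continuous (Y k) (simplex R k) R _ (incr k)).
      by move=> d; exact: discrete_open.
    move=> f; have hf := set_mem (valP f).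
    exact: (@sd_point_continuous k (set_val f) hf).
  - move=> _ _ [k i y t]; apply/funext => s /=; apply/esym.
    have hf := set_mem (valP y.2).
    exact: (@sd_point_face k i (set_val y.2) hf).
  by exists H; split=> // k x f t s; rewrite HE.
(* The homotopy on the realization of X. The colours 0, ..., k are not compatible
   with faces, but the projection forgets them. *)
have [K [cK KE]] : exists K : fat_realization R Y * R -> fat_realization R Y,
    continuous K /\ forall k (x : Y k) t s,
      K (fat_proj (fat_point x t), s) =
      fat_map fst_map (sd_point (@nat_of_ord k.+1) x t s).
  have [||K [cK KE]] := @fat_realization_homotopy R Y (fat_realization R Y)
    (fun p s => fat_map fst_map
      (sd_point (@nat_of_ord _) (projT2 p).1 (projT2 p).2 s)).
  - move=> k p; apply: (continuous_comp (@sd_point_continuous k _ (@id_colours k.+1) p)).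
    exact: fat_map_continuous.
  - by move=> _ _ [k i y t]; apply/funext => s /=; exact/esym/fat_map_sd_point_face.
  by exists K; split=> // k x t s; rewrite KE.
split; first exact: fat_map_continuous.
exists (fun q => G (q, 0)); split.
- have c0 : continuous (fun q : fat_realization R Y => (q, 0 : R)).
    apply: (@continuous_pair _ (fat_realization R Y) R id (fun=> 0)).
      by move=> q; exact: cvg_id.
    exact: cst_continuous.
  by move=> q; exact: (continuous_comp (c0 q) (cG _)).
- exists H; split; first exact: continuous_subspaceT.
  + move=> q; rewrite -(fat_reprK q); case: (fat_repr q) => k [[x f] t].
    rewrite HE /= fat_map_proj GE; apply: sd_point0 => //.
    exact: set_mem (valP f).
  + move=> q; rewrite -[in RHS](fat_reprK q) -[in LHS](fat_reprK q).
    case: (fat_repr q) => k [[x f] t].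
    have hf : {homo set_val f : i j / (i < j)%N} := set_mem (valP f).
    have colours_id : colours (set_val f) = f.
      by apply: val_inj; exact: val_colours.
    by rewrite HE sd_point1// colours_id.
- exists K; split; first exact: continuous_subspaceT.
  + move=> q; rewrite -(fat_reprK q); case: (fat_repr q) => k [x t].
    by rewrite KE /= GE.
  + move=> q; rewrite -[in RHS](fat_reprK q) -[in LHS](fat_reprK q).
    case: (fat_repr q) => k [x t].
    by rewrite KE sd_point1// fat_map_proj.
Qed.

End unravelling.

Theorem theorem1p1 (R : realType) (C : top_category)
    (hC : forall k : nat, has_CW_homotopy_type R (nerve C k)) :
  homotopy_equivalence R
    (fat_map (R := R) (ss_fst (underlying (nerve C)) incr)).
Proof. exact: fat_map_fst_homotopy_equivalence. Qed.
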